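(* (Formal unfoldings.) (a) Let $v(\xi;\lambda)$ be a smooth family of vector fields on a neighborhood of $0\in\mathbb{R}^3$, $\xi=(x,y,z)^T$, depending on parameters $\lambda$ near $0$, each divergence free, such that $v(\cdot;0)$ satisfies $v(0;0)=0$ and $D_\xi v(0;0)=N$. Then, up to terms of arbitrary degree in $(\xi,\lambda)$, a parameter-dependent volume-preserving near-identity change of coordinates brings the family into the form $$\dot\xi=N\xi+\hat e_3\big(\epsilon+\mu_1x+\mu_2y+p(x,y;\epsilon,\mu_1,\mu_2)\big),$$ where $\epsilon,\mu_1,\mu_2$ are unfolding parameters (depending on $\lambda$ and vanishing at $\lambda=0$) and the lowest order terms of $p$ in $(x,y)$ are quadratic. (b) Analogously, a smooth family of volume-preserving diffeomorphisms $f(\cdot;\lambda)$ with $f(0;0)=0$, $D_\xi f(0;0)=J=\mathbb{I}+N$ can, up to terms of arbitrary degree, be put by parameter-dependent volume-preserving near-identity coordinate changes into the form $$g(\xi)=J\Big(\xi+\hat e_3\big(\epsilon+\mu_1x+\mu_2y+p(x,y;\epsilon,\mu_1,\mu_2)\big)\Big),$$ with the lowest order terms of $p$ in $(x,y)$ quadratic.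
   Context: $N$ is the $3\times3$ matrix with $N_{12}=N_{23}=1$ and all other entries $0$; $\mathbb{I}$ is the $3\times3$ identity; $\hat e_3=(0,0,1)^T$.
   Formalization: p may depend on all of λ, not only via ε,μ1,μ2 (else false: v=Nξ+λx²ê3); families are polynomial jets in (ξ,λ) rather than smooth, and volume preservation of the coordinate change holds up to the chosen degree; smooth, exact versions follow by Taylor truncation and reparametrizing z. *)

(* Defs.v *)
From HB Require Import structures.
From mathcomp Require Import all_boot all_order all_algebra.
From mathcomp Require Import mpoly.
Set Implicit Arguments. Unset Strict Implicit. Unset Printing Implicit Defensive.
Import Order.TTheory GRing.Theory Num.Theory.
Local Open Scope ring_scope.

(* Formal (polynomial / jet) setting.  Variables are indexed by 'I_(3 + m):
   the first three are the phase variables xi = (x,y,z), the last m are the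
   parameters lambda = (lambda_1,...,lambda_m). *)

Section Defs.
Variable (R : realFieldType) (m : nat).
Local Notation P := {mpoly R[3 + m]}.

Definition xi (i : 'I_3) : P := 'X_(lshift m i).
Definition ix : 'I_3 := @Ordinal 3 0 isT.
Definition iy : 'I_3 := @Ordinal 3 1 isT.
Definition iz : 'I_3 := @Ordinal 3 2 isT.
Definition lam (j : 'I_m) : P := 'X_(rshift 3 j).

Definition Nmat : 'M[R]_3 := \matrix_(i < 3, j < 3) (((i : nat).+1 == j)%:R).
Definition Jmat : 'M[R]_3 := 1%:M + Nmat.

Definition at0 (p : P) : R := p@_(0%MM).
Definition dxi0 (p : P) (j : 'I_3) : R := p@_(mnm1 (lshift m j)).

Definition dxi (j : 'I_3) (p : P) : P := mderiv (lshift m j) p.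
Definition jac (v : 'I_3 -> P) : 'M[P]_3 := \matrix_(i < 3, j < 3) dxi j (v i).
Definition div (v : 'I_3 -> P) : P := \sum_(i < 3) dxi i (v i).

Definition subst (phi : 'I_3 -> P) (p : P) : P :=
  comp_mpoly [tuple (match split k with inl i => phi i | inr _ => 'X_k end)
             | k < 3 + m] p.

Definition eqmod (K : nat) (p q : P) : Prop :=
  forall mo : 'X_{1..3 + m}, (mdeg mo <= K)%N -> p@_mo = q@_mo.

Definition param_fun (q : P) : Prop :=
  at0 q = 0 /\
  forall mo : 'X_{1..3 + m}, q@_mo != 0 -> forall i : 'I_3, mo (lshift m i) = 0%N.

Definition higher_xy (p : P) : Prop :=
  forall mo : 'X_{1..3 + m}, p@_mo != 0 ->
    mo (lshift m iz) = 0%N /\ (2 <= mo (lshift m ix) + mo (lshift m iy))%N.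

Definition near_id (phi : 'I_3 -> P) : Prop :=
  forall i j : 'I_3, at0 (phi i) = 0 /\ dxi0 (phi i) j = (i == j)%:R.

Definition nf_scalar (eps mu1 mu2 p : P) : P := eps + mu1 * xi ix + mu2 * xi iy + p.

Definition nf_field (eps mu1 mu2 p : P) (i : 'I_3) : P :=
  \sum_(j < 3) Nmat i j *: xi j + (i == iz)%:R * nf_scalar eps mu1 mu2 p.

Definition nf_map (eps mu1 mu2 p : P) (i : 'I_3) : P :=
  \sum_(j < 3) Jmat i j *: (xi j + (j == iz)%:R * nf_scalar eps mu1 mu2 p).

End Defs.

(* Main.v *)
Require Import Defs.
From HB Require Import structures.
From mathcomp Require Import all_boot all_order all_algebra.
From mathcomp Require Import mpoly.
From mathcomp Require Import zify ring.
From Stdlib Require Import FunctionalExtensionality.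
Set Implicit Arguments. Unset Strict Implicit. Unset Printing Implicit Defensive.
Import Order.TTheory GRing.Theory Num.Theory.
Local Open Scope ring_scope.

(** Give every phase variable weight [M = K + 1] and every parameter weight
    [M + 1].  Then total degree at most [K] means weight less than [M (K + 1)],
    and every term of the family other than its linear part [N xi] or [J xi] has
    positive relative weight.  The change of variables is built by adding to
    [phi] (and to the normal form) terms of increasing weight, keeping
    [det D phi = 1] up to the current weight; no composition or flow is needed.

    For fields, with [D = y d_x + z d_y], a step asks for [h] and [k(x, y)] with
    [D h - N h = F - k e_3] and [div h = s], where [F] is the current defect and
    [-s] that of the determinant.  Eliminating [h_2] and [h_3] leaves the single
    equation [T h_1 = s + d_y F_1 + d_z D F_1 + d_z F_2] with
    [T = d_x + d_y D + d_z D^2].  Jacobi's formula for [d (det D phi)] gives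
    [div F = D s] to leading order, which forces [d_z k = 0].  For maps [D] is
    replaced by [p(J xi) - p] and Jacobi's formula by the chain rule for
    determinants.

    [T] is onto: in the basis [x^a y^b z^c / (a! b! c! 2^c)] it acts on each line
    [a + b + c], [b + 2 c] fixed, as a three-term operator which commutes with
    the forward difference and multiplies constants by a nonzero number, so one
    solves by induction, summing the solution of the differenced equation.  The
    version for maps is a perturbation of [T] lowering [2 a + b] further, and is
    inverted by a finite Neumann iteration. *)

(** * Supports of polynomials and weighted orders *)

Lemma mnm_ind n (Q : 'X_{1..n} -> Prop) :
  Q 0%MM -> (forall i mo, Q mo -> Q (U_(i) + mo)%MM) -> forall mo, Q mo.
Proof.
move=> Q0 QS mo; move: {2}(mdeg mo) (erefl (mdeg mo)) => d.
elim: d mo => [|d IHd] mo; first by move/eqP; rewrite mdeg_eq0 => /eqP->.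
move=> dmo; have /existsP[i moi] : [exists i, mo i != 0%N].
  apply: contraT => /existsPn mo0; move: dmo.
  by rewrite mdegE big1 // => i _; apply/eqP; move: (mo0 i); rewrite negbK.
have le_i : (U_(i) <= mo)%MM by rewrite lep1mP.
rewrite -(submK le_i) addmC; apply: QS; apply: IHd.
by move: dmo; rewrite -{1}(submK le_i) mdegD mdeg1 addn1 => -[].
Qed.

Section Support.
Variables (R : comNzRingType) (n : nat).
Implicit Types (p q : {mpoly R[n]}) (mo : 'X_{1..n}) (S T U : pred 'X_{1..n}).

Definition supp S p := forall mo, p@_mo != 0 -> S mo.

Lemma supp0 S : supp S 0.
Proof. by move=> mo; rewrite mcoeff0 eqxx. Qed.

Lemma suppD S p q : supp S p -> supp S q -> supp S (p + q).
Proof.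
move=> hp hq mo; rewrite mcoeffD; have [->|/hp //] := eqVneq (p@_mo) 0.
by rewrite add0r => /hq.
Qed.

Lemma suppN S p : supp S p -> supp S (- p).
Proof. by move=> hp mo; rewrite mcoeffN oppr_eq0 => /hp. Qed.

Lemma suppB S p q : supp S p -> supp S q -> supp S (p - q).
Proof. by move=> hp hq; apply/suppD/suppN. Qed.

Lemma suppZ S c p : supp S p -> supp S (c *: p).
Proof.
move=> hp mo; rewrite mcoeffZ => h; apply: hp.
by apply: contraNneq h => ->; rewrite mulr0.
Qed.

Lemma supp_sum S (I : Type) (r : seq I) (Q : pred I) (F : I -> {mpoly R[n]}) :
  (forall i, Q i -> supp S (F i)) -> supp S (\sum_(i <- r | Q i) F i).
Proof. by move=> h; elim/big_ind: _ => //; [exact: supp0 | exact: suppD]. Qed.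

Lemma suppX S mo : S mo -> supp S 'X_[mo].
Proof.
by move=> Smo mo1; rewrite mcoeffX; have [<-|_] := eqVneq mo mo1; rewrite ?eqxx.
Qed.

Lemma suppW S T p : (forall mo, S mo -> T mo) -> supp S p -> supp T p.
Proof. by move=> ST hp mo /hp /ST. Qed.

Lemma suppM S T U p q :
    (forall mo mo', S mo -> T mo' -> U (mo + mo')%MM) ->
  supp S p -> supp T q -> supp U (p * q).
Proof.
move=> STU hp hq mo; rewrite -mcoeff_msupp => /msuppM_le /allpairsP.
by case=> -[m1 m2] /= []; rewrite !mcoeff_msupp => /hp h1 /hq h2 ->; apply: STU.
Qed.

Lemma supp_mderiv S T i p :
  (forall mo, S (mo + U_(i))%MM -> T mo) -> supp S p -> supp T p^`M(i).
Proof.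
move=> ST hp mo; rewrite mcoeff_deriv => h; apply/ST/hp.
by apply: contraNneq h => ->; rewrite mul0rn.
Qed.

(** Linearity is a plain hypothesis, so that differences of operators such as [dshift p - shear p]
    are covered without a bundled structure. *)
Lemma supp_linear (f : {mpoly R[n]} -> {mpoly R[n]}) S T p :
    linear f -> (forall mo, S mo -> supp T (f 'X_[mo])) ->
  supp S p -> supp T (f p).
Proof.
move=> lf hf hp.
have f0 : f 0 = 0 by have := lf (-1) 0 0; rewrite scaler0 addr0 scaleN1r addNr.
(* The list is generalised to any part of the support, so that induction applies while the
   coefficients stay those of [p]. *)
rewrite {1}[p]mpolyE; suff: forall s, {subset s <= msupp p} ->
  supp T (f (\sum_(mo <- s) p@_mo *: 'X_[mo])) by apply.
elim=> [|mo s IHs] hs; first by rewrite big_nil f0; apply: supp0.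
rewrite big_cons lf; apply: suppD; last first.
  by apply: IHs => mo' ?; apply: hs; rewrite inE orbC; apply/orP; left.
apply/suppZ/hf/hp; rewrite -mcoeff_msupp; apply: hs.
by rewrite inE eqxx.
Qed.

Lemma supp_pred0 S p : (forall mo, ~~ S mo) -> supp S p -> p = 0.
Proof.
move=> S0 hp; apply/mpolyP=> mo; rewrite mcoeff0; apply/eqP/negPn/negP => /hp.
by apply/negP.
Qed.

Definition filt S p := \sum_(mo <- msupp p | S mo) p@_mo *: 'X_[mo].

Lemma mcoeff_filt S p mo : (filt S p)@_mo = if S mo then p@_mo else 0.
Proof.
rewrite /filt raddf_sum /=.
have h mo' : mo' \in msupp p -> (p@_mo' *: 'X_[mo'])@_mo = (mo' == mo)%:R * p@_mo.
  by move=> _; rewrite mcoeffZ mcoeffX; case: eqP => [->|_]; rewrite ?mulr1 ?mul1r ?mulr0 ?mul0r.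
rewrite big_seq_cond (eq_bigr (fun mo' => (mo' == mo)%:R * p@_mo)); last first.
  by move=> mo' /andP[/h].
rewrite -big_seq_cond; case: ifP => Smo; last first.
  by rewrite big1 // => mo' Smo'; case: eqP Smo' => [->|]; rewrite ?Smo ?mul0r.
have [inp|/memN_msupp_eq0 ->] := boolP (mo \in msupp p); last first.
  by rewrite big1 // => ? _; rewrite mulr0.
rewrite big_mkcond (bigD1_seq mo) ?msupp_uniq //= Smo eqxx mul1r big1_seq ?addr0 //.
by move=> mo' /andP[/negPf-> _]; rewrite mul0r if_same.
Qed.

Lemma supp_filt S T p : supp T p -> supp (fun mo => S mo && T mo) (filt S p).
Proof. by move=> hp mo; rewrite mcoeff_filt; case: ifP => [Smo /hp Tmo|]; rewrite ?Smo ?eqxx. Qed.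

Variable w : 'I_n -> nat.

Definition wt mo := (\sum_(i < n) w i * mo i)%N.

Lemma wtD mo mo' : wt (mo + mo')%MM = (wt mo + wt mo')%N.
Proof. by rewrite /wt -big_split /=; apply: eq_bigr => i _; rewrite mnmDE mulnDr. Qed.

Lemma wtU i : wt U_(i)%MM = w i.
Proof.
rewrite /wt (bigD1 i) //= mnm1E eqxx muln1 big1 ?addn0 // => j /negPf.
by rewrite mnm1E eq_sym => ->; rewrite muln0.
Qed.

Lemma wt0 : wt 0%MM = 0%N.
Proof. by rewrite /wt big1 // => i _; rewrite mnm0E muln0. Qed.

Definition ord k p := supp (fun mo => (k <= wt mo)%N) p.

(* All monomials have weight at most [v - k]; differentiating raises [k]. *)
Definition ubord k v p := supp (fun mo => (k + wt mo <= v)%N) p.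

Lemma ord_le k k' p : (k' <= k)%N -> ord k p -> ord k' p.
Proof. by move=> le_k; apply: suppW => mo; apply: leq_trans. Qed.

Lemma ordM k k' p q : ord k p -> ord k' q -> ord (k + k') (p * q).
Proof. by apply: suppM => mo mo'; rewrite wtD; apply: leq_add. Qed.

(** Truncated subtraction is harmless here: order 0 is no condition. *)
Lemma ord_mderiv i k p : ord k p -> ord (k - w i) p^`M(i).
Proof. by apply: supp_mderiv => mo; rewrite wtD wtU leq_subLR addnC. Qed.

Lemma ord_0 p : ord 0 p.
Proof. by []. Qed.

Lemma ordXU i : ord (w i) 'X_i.
Proof. by apply: suppX; rewrite wtU. Qed.

Lemma ubordM k k' v v' p q :
  ubord k v p -> ubord k' v' q -> ubord (k + k') (v + v') (p * q).
Proof.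
by apply: suppM => mo mo'; rewrite wtD => h h'; rewrite addnACA; apply: leq_add.
Qed.

Lemma ubord_mderiv i k v p : ubord k v p -> ubord (k + w i) v p^`M(i).
Proof. by apply: supp_mderiv => mo; rewrite wtD wtU addnA addnAC. Qed.

Lemma ubord_le k k' v p : (k' <= k)%N -> ubord k v p -> ubord k' v p.
Proof. by move=> le_k; apply: suppW => mo; apply: leq_trans; rewrite leq_add2r. Qed.

End Support.

(** * The three-term operator on a line and its right inverse *)

Section LineOperator.
Variable R : realFieldType.
Implicit Types (k c : nat) (s u : nat -> R).

(* [div_op shear] on coefficients along a line, see [mcoeff_div_op_shear]; [b] is
   the exponent of y and [c] that of z. *)
Definition line_op k u c : R :=
  let b := (k - 2 * c)%N in
  (3 + 3 * b + c + 2 * b * c)%N%:R * u c + 'C(b, 2)%:R * u c.+1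
  + (2 * c * c.+2)%N%:R * u c.-1.

(** The eigenvalue of [line_op k] on constant sequences, read off at [c = 0]. *)
Definition line_const k : R := (3 + 3 * k + 'C(k, 2))%N%:R.

Lemma line_const_neq0 k : line_const k != 0.
Proof. by rewrite /line_const pnatr_eq0. Qed.

(** At [k + 2] and [c + 1] the exponent [b] has the value it has at [k] and [c], hence the drop of
    the index by two. The coefficients are quadratic in [b] and [c], so the rest is computation. *)
Lemma line_op_shift k u c : (2 * c <= k)%N ->
  line_op k.+2 u c.+1 - line_op k.+2 u c = line_op k (fun i => u i.+1 - u i) c.
Proof.
move=> le_c; rewrite /line_op.
have -> : (k.+2 - 2 * c.+1 = k - 2 * c)%N by lia.
have -> : (k.+2 - 2 * c = (k - 2 * c).+2)%N by lia.
set b := (k - 2 * c)%N.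
have -> : ('C(b.+2, 2) = 'C(b, 2) + 2 * b + 1)%N by rewrite !binS !bin1 !bin0; lia.
(* At [c = 0] the entry [u c.-1] is a default value, killed by the factor [c]. *)
case: c {le_c} @b => [|c] b /=; rewrite ?muln0 ?mul0n ?mul0r;
  move: 'C(b, 2) (u _) (u _.+1) (u _.+2) => C x y z; [ring | move: (u c) => t; ring].
Qed.

(** Discrete integration: sum the solution of the differenced equation, then fix the constant of
    summation by the equation at [c = 0]. For [k] at most 1 that equation is the only one, and it is
    diagonal. *)
Fixpoint line_sol k s : nat -> R :=
  match k with
  | k1.+2 =>
    let u0 c := \sum_(i < c) line_sol k1 (fun i => s i.+1 - s i) i in
    fun c => u0 c + (s 0%N - line_op k u0 0) / line_const k
  | _ => fun=> s 0%N / line_const k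
  end.

Lemma line_solP k s c : (2 * c <= k)%N -> line_op k (line_sol k s) c = s c.
Proof.
elim/ltn_ind: k s c => -[|[|k]] IH s c le_c.
- have -> : c = 0%N by lia.
  have := line_const_neq0 0; rewrite /line_op /line_const /= muln0 subn0 bin_small //.
  by rewrite ?(muln0, mul0n, addn0, mul0r, addr0) mulrCA => h; rewrite divff ?mulr1.
- have -> : c = 0%N by lia.
  have := line_const_neq0 1; rewrite /line_op /line_const /= muln0 subn0 bin_small //.
  by rewrite ?(muln0, mul0n, addn0, mul0r, addr0) mulrCA => h; rewrite divff ?mulr1.
elim: c le_c => [_|c IHc le_c].
  pose u0 c := \sum_(i < c) line_sol k (fun i => s i.+1 - s i) i.
  have E i : line_sol k.+2 s i = u0 i + (s 0%N - line_op k.+2 u0 0) / line_const k.+2 by [].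
  rewrite {1}/line_op !E; set t := _ / _.
  have -> : s 0%N = line_op k.+2 u0 0 + line_const k.+2 * t.
    by rewrite mulrC divfK ?line_const_neq0 // addrC subrK.
  rewrite /line_op /line_const subn0 !muln0 !mul0n !addn0 !mul0r.
  by move: t (u0 _) (u0 _) => t x y; ring.
have le_c1 : (2 * c <= k)%N by lia.
(* Given the equation at [c], the one at [c + 1] amounts to the differenced equation, which holds by
   induction on [k]. *)
apply/(addIr (- line_op k.+2 (line_sol k.+2 s) c)).
rewrite line_op_shift // IHc; last by lia.
rewrite -[RHS](IH k _ (fun i => s i.+1 - s i) c) //.
rewrite /line_op; set v := line_sol k.
have E i : line_sol k.+2 s i.+1 - line_sol k.+2 s i = v (fun i => s i.+1 - s i) i.
  by rewrite /= big_ord_recr /= -/v; ring.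
by rewrite !E.
Qed.

(** Ensures that the solution lives only on lines met by the source. *)
Lemma line_sol0 k s : (forall c, (2 * c <= k)%N -> s c = 0) ->
  forall c, (2 * c <= k)%N -> line_sol k s c = 0.
Proof.
elim/ltn_ind: k s => -[|[|k]] IH s s0 c le_c.
- by rewrite /= s0 // mul0r.
- by rewrite /= s0 // mul0r.
have v0 i : (2 * i <= k)%N -> line_sol k (fun i => s i.+1 - s i) i = 0.
  by apply: IH => // j le_j; rewrite !s0 ?subrr //; lia.
rewrite /= /line_op !big_ord0 big_ord1 /= v0 // s0 // !mulr0 !addr0.
rewrite subr0 mul0r addr0 big1 // => i _; apply: v0; have := ltn_ord i; lia.
Qed.

End LineOperator.

(** * Phase derivatives and the coefficients of [div_op shear] *)

Lemma ord3_ind (Q : 'I_3 -> Prop) : Q ix -> Q iy -> Q iz -> forall i, Q i.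
Proof.
move=> Qx Qy Qz [[|[|[|i]]] hi] //.
- by rewrite (_ : Ordinal hi = ix) //; apply: val_inj.
- by rewrite (_ : Ordinal hi = iy) //; apply: val_inj.
- by rewrite (_ : Ordinal hi = iz) //; apply: val_inj.
Qed.

Lemma big_ord3 (V : nmodType) (F : 'I_3 -> V) :
  \sum_(i < 3) F i = F ix + F iy + F iz.
Proof.
rewrite !big_ord_recl big_ord0 addr0 addrA.
by congr (F _ + F _ + F _); apply: val_inj.
Qed.

Section Phase.
Variables (R : realFieldType) (m : nat).
Local Notation P := {mpoly R[3 + m]}.
Local Notation mon := 'X_{1..3 + m}.
Implicit Types (p q : P) (mo : mon).

Definition xexp (i : 'I_3) mo : nat := mo (lshift m i).
Definition lexp mo (j : 'I_m) : nat := mo (rshift 3 j).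

Lemma split_ind (Q : 'I_(3 + m) -> Prop) :
  (forall i, Q (lshift m i)) -> (forall j, Q (rshift 3 j)) -> forall k, Q k.
Proof. by move=> Ql Qr k; rewrite -(splitK k); case: (split k). Qed.

Lemma wt_split w mo : wt w mo =
  (w (lshift m ix) * xexp ix mo + w (lshift m iy) * xexp iy mo
   + w (lshift m iz) * xexp iz mo + \sum_(j < m) w (rshift 3 j) * lexp mo j)%N.
Proof. by rewrite /wt big_split_ord /= big_ord3. Qed.

Lemma mdeg_wt mo : mdeg mo = wt (fun=> 1%N) mo.
Proof. by rewrite mdegE /wt; apply: eq_bigr => i _; rewrite mul1n. Qed.

Lemma dxiD j : {morph @dxi R m j : p q / p + q}.
Proof. exact: mderivD. Qed.

Lemma dxiB j : {morph @dxi R m j : p q / p - q}.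
Proof. exact: mderivB. Qed.

Lemma dxiN j : {morph @dxi R m j : p / - p}.
Proof. exact: mderivN. Qed.

Lemma dxiZ j c p : dxi j (c *: p) = c *: dxi j p.
Proof. exact: mderivZ. Qed.

Lemma dxiM j p q : dxi j (p * q) = dxi j p * q + p * dxi j q.
Proof. exact: mderivM. Qed.

Lemma dxi_comm i j p : dxi i (dxi j p) = dxi j (dxi i p).
Proof. exact: mderiv_comm. Qed.

Lemma dxiXU j k : dxi j ('X_k : P) = (lshift m j == k)%:R.
Proof.
rewrite /dxi mderivX mnm1E eq_sym; case: eqP => [->|_]; last by rewrite scale0r.
rewrite (_ : U_(k) - U_(k) = 0)%MM ?mpolyX0 ?scale1r //.
by apply/mnmP=> i; rewrite mnmBE subnn mnm0E.
Qed.

Lemma dxi_xi i j : dxi j (xi R m i) = (i == j)%:R.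
Proof. by rewrite dxiXU eq_sym (inj_eq (@lshift_inj _ _)). Qed.

Lemma dxiC j c : dxi j (c%:MP : P) = 0.
Proof. exact: mderivC. Qed.

Lemma dxi_cst0 j : dxi j (0 : P) = 0.
Proof. exact: mderiv0. Qed.

Lemma dxi_cst1 j : dxi j (1 : P) = 0.
Proof. exact: dxiC. Qed.

(** The derivation along the linear field [N xi], written [D] in the overview. *)
Definition shear p : P := xi R m iy * dxi ix p + xi R m iz * dxi iy p.

(* The divergence of [(p, B p, B (B p))]. *)
Definition div_op (B : P -> P) p : P := dxi ix p + dxi iy (B p) + dxi iz (B (B p)).

Lemma mcoeff_dxi i p mo : (dxi i p)@_mo = (xexp i mo).+1%:R * p@_(U_(lshift m i) + mo).
Proof. by rewrite /dxi mcoeff_deriv addmC mulr_natl. Qed.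

Lemma mcoeff_xiM i p mo :
  (xi R m i * p)@_mo = if xexp i mo is _.+1 then p@_(mo - U_(lshift m i)) else 0.
Proof.
case E : (xexp i mo) => [|e]; last first.
  have le_i : (U_(lshift m i) <= mo)%MM by rewrite lep1mP; move: E; rewrite /xexp => ->.
  by rewrite -{1}(submK le_i) /xi mulrC addmC mcoeffMX.
apply: memN_msupp_eq0.
apply/negP => /msuppM_le /allpairsP[[m1 m2] /= [h1 _ Emo]].
move: h1; rewrite msuppX inE => /eqP E1.
by move: E; rewrite /xexp Emo E1 mnmDE mnm1E eqxx.
Qed.

Lemma xexpU i j mo : xexp i (U_(lshift m j) + mo)%MM = ((j == i) + xexp i mo)%N.
Proof. by rewrite /xexp mnmDE mnm1E (inj_eq (@lshift_inj _ _)). Qed.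

Lemma xexpB i j mo : xexp i (mo - U_(lshift m j))%MM = (xexp i mo - (j == i))%N.
Proof. by rewrite /xexp mnmBE mnm1E (inj_eq (@lshift_inj _ _)). Qed.

Lemma lexpU i mo : lexp (U_(lshift m i) + mo)%MM =1 lexp mo.
Proof. by move=> j; rewrite /lexp mnmDE mnm1E eq_lrshift. Qed.

Lemma lexpB i mo : lexp (mo - U_(lshift m i))%MM =1 lexp mo.
Proof. by move=> j; rewrite /lexp mnmBE mnm1E eq_lrshift subn0. Qed.

(** In this expansion every summand sends a monomial to a multiple of a monomial and changes the
    exponent of z by 0, 1 or -1: these are the three terms of [line_op]. *)
Lemma div_op_shearE p : div_op shear p =
  let x := xi R m ix in let y := xi R m iy in let z := xi R m iz in
  let dx := @dxi R m ix in let dy := @dxi R m iy in let dz := @dxi R m iz in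
  3 * dx p + 3 * (y * dy (dx p)) + 3 * (z * dy (dy p)) + y * (y * dx (dx (dz p)))
  + 2 * (y * (dy (z * (dz (dx p))))) + z * (z * dy (dy (dz p))) + z * dz (dx p).
Proof.
rewrite /div_op /shear /=.
rewrite !(dxiD, dxiM, dxi_xi, dxi_cst0, dxi_cst1) /=.
rewrite !(dxi_comm iz ix, dxi_comm iz iy, dxi_comm iy ix).
ring.
Qed.


(** Multiplying coefficients by this number passes to the rescaled basis, in which the operator no
    longer involves the exponent [a]. *)
Definition divpow_fact (a b c : nat) : R := (a`!%:R * b`!%:R) * (c`!%:R * 2 ^+ c).

Lemma divpow_fact_neq0 a b c : divpow_fact a b c != 0.
Proof. by rewrite !mulf_neq0 ?expf_neq0 ?pnatr_eq0 -?lt0n ?fact_gt0. Qed.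

Lemma divpow_factSx a b c : divpow_fact a.+1 b c = a.+1%:R * divpow_fact a b c.
Proof. by rewrite /divpow_fact factS natrM -!mulrA. Qed.

Lemma divpow_factSy a b c : divpow_fact a b.+1 c = b.+1%:R * divpow_fact a b c.
Proof. by rewrite /divpow_fact factS natrM -!mulrA mulrCA. Qed.

Lemma divpow_factSz a b c : divpow_fact a b c.+1 = 2 * c.+1%:R * divpow_fact a b c.
Proof. by rewrite /divpow_fact factS natrM exprS; ring. Qed.

Lemma mcoeff_div_op_shear p mo (f : nat -> R) a b c :
    xexp ix mo = a -> xexp iy mo = b -> xexp iz mo = c ->
    (forall mo', lexp mo' =1 lexp mo ->
       (xexp ix mo' + xexp iy mo' + xexp iz mo' = (a + b + c).+1)%N ->
       (xexp iy mo' + 2 * xexp iz mo' = b + 2 * c)%N ->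
     p@_mo' * divpow_fact (xexp ix mo') (xexp iy mo') (xexp iz mo') = f (xexp iz mo')) ->
  (div_op shear p)@_mo * divpow_fact a b c = line_op (b + 2 * c) f c.
Proof.
move=> Ea Eb Ec Hf.
have Cm n q mo' : (n%:R * q : P)@_mo' = n%:R * q@_mo'.
  by rewrite !mulr_natl mcoeffMn.
have {}Hf mo' : lexp mo' =1 lexp mo ->
       (xexp ix mo' + xexp iy mo' + xexp iz mo' = (a + b + c).+1)%N ->
       (xexp iy mo' + 2 * xexp iz mo' = b + 2 * c)%N ->
     p@_mo' = f (xexp iz mo') / divpow_fact (xexp ix mo') (xexp iy mo') (xexp iz mo').
  by move=> h1 h2 h3; rewrite -(Hf mo') // mulfK // divpow_fact_neq0.
have binE n : 'C(n.+2, 2)%:R = n.+2%:R * n.+1%:R / 2 :> R.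
  have two0 : 2 != 0 :> R by rewrite pnatr_eq0.
  by apply: (mulIf two0); rewrite divfK // -!natrM (bin_ffact _ 2) ffactnS ffactn1.
rewrite div_op_shearE /= !mcoeffD !Cm !mcoeff_xiM.
rewrite !(mcoeff_dxi, mcoeff_xiM, xexpU, xexpB).
rewrite Ea Eb Ec /line_op addnK.
(* Factors y^2, z and z^2 in the expansion kill a coefficient whose exponent is too small, so
   exponents 0, 1 and at least 2 are treated apart. *)
case: b Eb Hf => [|[|b]] Eb Hf; case: c Ec Hf => [|[|c]] Ec Hf;
  rewrite ?(add0n, add1n, subn0, subn1) /=.
all: rewrite !Hf; try (by move=> j; rewrite ?(lexpU, lexpB));
  try (by rewrite !(xexpU, xexpB) ?Ea ?Eb ?Ec /=; lia).
all: rewrite !(xexpU, xexpB) Ea Eb Ec /=.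
all: rewrite ?(add0n, add1n, subn0, subn1, addn0) /= ?(divpow_factSx, divpow_factSy, divpow_factSz).
all: rewrite ?binE ?(bin_small (n := 1)) ?(bin_small (n := 0)) //.
all: have := divpow_fact_neq0 a 0 0; try have := divpow_fact_neq0 a b 0;
  try have := divpow_fact_neq0 a 0 c; try have := divpow_fact_neq0 a b c.
all: clear Hf; move: divpow_fact => F; intros; field.
all: by do ?[apply/andP; split]; rewrite ?nat1r -?natrD ?pnatr_eq0.
Qed.

End Phase.

(** * Surjectivity of [div_op shear], line by line *)

Lemma mpoly_of_coeffs (R : nzRingType) (n : nat) (f : 'X_{1..n} -> R) N :
  (forall mo, (N <= mdeg mo)%N -> f mo = 0) ->
  exists p : {mpoly R[n]}, forall mo, p@_mo = f mo.
Proof.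
move=> f0; exists (\sum_(mo : 'X_{1..n < N}) f mo *: 'X_[mo]) => mo.
rewrite raddf_sum /=.
have [ltN|leN] := ltnP (mdeg mo) N; last first.
  rewrite (f0 _ leN) big1 // => i _; rewrite mcoeffZ mcoeffX.
  by case: eqP => [E|]; rewrite ?mulr0 //; move: leN; rewrite -E leqNgt bmdeg.
rewrite (bigD1 (BMultinom ltN)) //= mcoeffZ mcoeffX eqxx mulr1 big1 ?addr0 // => i.
move=> neq; rewrite mcoeffZ mcoeffX; case: eqP => [E|]; rewrite ?mulr0 //.
by case/negP: neq; apply/eqP/val_inj.
Qed.

Section Phase.
Variables (R : realFieldType) (m : nat).
Local Notation P := {mpoly R[3 + m]}.
Local Notation mon := 'X_{1..3 + m}.
Implicit Types (p q s : P) (mo : mon).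

(** The operator [div_op shear] lowers [phase_deg] by one and preserves [line_deg] and the parameter
    exponents; these data label the lines. *)
Definition phase_deg mo := (xexp ix mo + xexp iy mo + xexp iz mo)%N.
Definition line_deg mo := (xexp iy mo + 2 * xexp iz mo)%N.

(* The monomial with z-exponent [c] on the line of the target of [div_op shear]
   that corresponds to [mo]; meaningful if [line_deg mo - c < phase_deg mo]. *)
Definition line_mnm mo c : mon := [multinom
  (match split k with
   | inl i => nth 0%N [:: (phase_deg mo).-1 - (line_deg mo - c); line_deg mo - 2 * c; c]%N i
   | inr j => lexp mo j end) | k < 3 + m].

Lemma xexp_line_mnm i mo c : xexp i (line_mnm mo c) =
  nth 0%N [:: (phase_deg mo).-1 - (line_deg mo - c); line_deg mo - 2 * c; c]%N i.
Proof. by rewrite /xexp mnmE -[lshift m i]/(unsplit (inl i)) unsplitK. Qed.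

Lemma lexp_line_mnm mo c : lexp (line_mnm mo c) =1 lexp mo.
Proof. by move=> j; rewrite {1}/lexp mnmE -[rshift 3 j]/(unsplit (inr j)) unsplitK. Qed.

Lemma mnm_ext mo mo' : (forall i, xexp i mo = xexp i mo') -> lexp mo =1 lexp mo' -> mo = mo'.
Proof. by move=> hx hl; apply/mnmP; apply: split_ind. Qed.

Lemma line_mnm_ext mo mo' c : phase_deg mo = phase_deg mo' -> line_deg mo = line_deg mo' ->
  lexp mo =1 lexp mo' -> line_mnm mo c = line_mnm mo' c.
Proof.
move=> hh hl he; apply: mnm_ext => [i|j]; first by rewrite !xexp_line_mnm hh hl.
by rewrite !lexp_line_mnm.
Qed.

Lemma mdeg_split mo : mdeg mo = (phase_deg mo + \sum_(j < m) lexp mo j)%N.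
Proof.
by rewrite mdeg_wt wt_split !mul1n /phase_deg; congr addn; apply: eq_bigr => j _; rewrite mul1n.
Qed.

(** Each line is solved by [line_sol]. The support clause serves to carry both gradings from [s]
    over to [h]. *)
Lemma div_op_shear_surj s : exists h, div_op (@shear R m) h = s /\
  forall mo, h@_mo != 0 -> exists mo', [/\ s@_mo' != 0, phase_deg mo = (phase_deg mo').+1,
    line_deg mo = line_deg mo' & lexp mo =1 lexp mo'].
Proof.
(* Points of the line with a negative exponent carry no monomial and get the value 0. Equations at
   true monomials couple, with nonzero coefficient, only true monomials. *)
pose lseq mo c : R := if ((line_deg mo - c < phase_deg mo) && (2 * c <= line_deg mo))%N then
     s@_(line_mnm mo c)
     * divpow_fact R ((phase_deg mo).-1 - (line_deg mo - c)) (line_deg mo - 2 * c) c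
   else 0.
pose f mo := line_sol (line_deg mo) (lseq mo) (xexp iz mo)
    / divpow_fact R (xexp ix mo) (xexp iy mo) (xexp iz mo).
have f_supp mo : f mo != 0 -> exists mo', [/\ s@_mo' != 0, phase_deg mo = (phase_deg mo').+1,
    line_deg mo = line_deg mo' & lexp mo =1 lexp mo'].
  rewrite mulf_eq0 negb_or => /andP[nz _].
  (* By contraposition: if [s] vanishes along the whole line, so does the solution. *)
  have [|/existsPn all0] := boolP [exists c : 'I_(line_deg mo).+1,
    [&& (line_deg mo - c < phase_deg mo)%N, (2 * c <= line_deg mo)%N & s@_(line_mnm mo c) != 0]].
    case/existsP=> c /and3P[lt_c le_c nzs]; exists (line_mnm mo c); split=> //.
    - by rewrite /phase_deg !xexp_line_mnm /= -/(phase_deg mo); lia.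
    - by rewrite {2}/line_deg !xexp_line_mnm /=; lia.
    - by move=> j; rewrite lexp_line_mnm.
  case/negP: nz; apply/eqP/line_sol0; last by rewrite /line_deg; lia.
  move=> c le_c; rewrite /lseq; case: ifP => // /andP[lt_c _].
  have lt_c1 : (c < (line_deg mo).+1)%N by lia.
  have := all0 (Ordinal lt_c1); rewrite /= lt_c le_c /= negbK => /eqP->.
  by rewrite mul0r.
have [|h hE] := @mpoly_of_coeffs R _ f (msize s).+1.
  move=> mo; rewrite mdeg_split => big; apply/eqP/negPn/negP => /f_supp[mo' [nz Eh El Ee]].
  move: nz; rewrite -mcoeff_msupp => /msize_mdeg_lt; rewrite mdeg_split.
  have ES : (\sum_(j < m) lexp mo j = \sum_(j < m) lexp mo' j)%N.
    by apply: eq_bigr => j _; rewrite Ee.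
  by move: big; rewrite Eh ES; move: (msize s) (\sum_(j < m) _)%N => a b; lia.
exists h; split=> [|mo]; last by rewrite hE => /f_supp.
apply/mpolyP => mo.
(* The monomial x times [mo] always lies on the source line belonging to [mo] and represents it. *)
have El0 : line_deg (U_(lshift m ix) + mo)%MM = line_deg mo by rewrite /line_deg !xexpU.
have Eh0 : phase_deg (U_(lshift m ix) + mo)%MM = (phase_deg mo).+1 by rewrite /phase_deg !xexpU.
have nz := divpow_fact_neq0 R (xexp ix mo) (xexp iy mo) (xexp iz mo).
apply: (mulIf nz).
rewrite (@mcoeff_div_op_shear _ _ h mo (line_sol (line_deg mo) (lseq (U_(lshift m ix) + mo)%MM))
  (xexp ix mo) (xexp iy mo) (xexp iz mo)) //.
  rewrite line_solP; last by rewrite /line_deg; lia.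
  rewrite /lseq El0 Eh0 ifT; last by rewrite /line_deg /phase_deg; lia.
  rewrite (_ : line_mnm _ _ = mo); last first.
    apply: mnm_ext => [|j]; last by rewrite lexp_line_mnm lexpU.
    by apply: ord3_ind; rewrite xexp_line_mnm El0 Eh0 /= ?/phase_deg /line_deg; lia.
  by congr (_ * divpow_fact _ _ _ _); rewrite /line_deg /phase_deg /=; lia.
move=> mo' he hh hl; rewrite hE /f divfK ?divpow_fact_neq0 //.
have El : line_deg mo' = line_deg (U_(lshift m ix) + mo)%MM by rewrite El0 {1}/line_deg hl.
have Eh : phase_deg mo' = phase_deg (U_(lshift m ix) + mo)%MM by rewrite Eh0 {1}/phase_deg hh.
have Ee : lexp mo' =1 lexp (U_(lshift m ix) + mo)%MM by move=> j; rewrite lexpU he.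
have E : lseq mo' = lseq (U_(lshift m ix) + mo)%MM.
  apply: functional_extensionality => c.
  by rewrite /lseq El Eh (line_mnm_ext c Eh El Ee).
by rewrite E El El0.
Qed.
End Phase.

(** * The two gradings and surjectivity of the perturbed operator *)

Section Weights.
Variables (R : realFieldType) (m : nat).
Local Notation P := {mpoly R[3 + m]}.
Local Notation mon := 'X_{1..3 + m}.
Implicit Types (p q s : P) (mo : mon).

Definition mkwt (u : seq nat) (l : nat) (k : 'I_(3 + m)) : nat :=
  match split k with inl i => nth 0%N u i | inr _ => l end.

Lemma mkwt_l u l i : mkwt u l (lshift m i) = nth 0%N u i.
Proof. by rewrite /mkwt -[lshift m i]/(unsplit (inl i)) unsplitK. Qed.

Lemma mkwt_r u l j : mkwt u l (rshift 3 j) = l.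
Proof. by rewrite /mkwt -[rshift 3 j]/(unsplit (inr j)) unsplitK. Qed.

Lemma wt_mkwt u l mo : wt (mkwt u l) mo =
  (nth 0 u 0 * xexp ix mo + nth 0 u 1 * xexp iy mo + nth 0 u 2 * xexp iz mo
   + l * \sum_(j < m) lexp mo j)%N.
Proof.
rewrite wt_split !mkwt_l big_distrr /=; congr addn.
by apply: eq_bigr => j _; rewrite mkwt_r.
Qed.

(** The linear part has weight [M]; a lone parameter has weight [M + 1] and thus already counts as a
    perturbation. *)
Definition grade M := mkwt [:: M; M; M] M.+1.
(** These weights make [shear] lower the level by exactly one, and leave the parameters out. *)
Definition level := mkwt [:: 2; 1; 0]%N 0.

Lemma grade_xi M i : grade M (lshift m i) = M.
Proof. by rewrite /grade mkwt_l; move: i; apply: ord3_ind. Qed.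

Lemma wt_grade M mo : wt (grade M) mo = (M * phase_deg mo + M.+1 * \sum_(j < m) lexp mo j)%N.
Proof. by rewrite wt_mkwt /= /phase_deg !mulnDr. Qed.

Lemma wt_level mo : wt level mo = (2 * xexp ix mo + xexp iy mo)%N.
Proof. by rewrite wt_mkwt /= !mul0n mul1n !addn0. Qed.

Lemma ord_dxi M n i p : ord (grade M) n p -> ord (grade M) (n - M) (dxi i p).
Proof. by move=> /(@ord_mderiv _ _ _ (lshift m i)); rewrite grade_xi. Qed.

Lemma ord_dxiK M n i p : ord (grade M) (M + n) p -> ord (grade M) n (dxi i p).
Proof. by move=> /(@ord_dxi _ _ i); rewrite addKn. Qed.

Lemma ord_xi M i : ord (grade M) M (xi R m i).
Proof. by rewrite -{2}(grade_xi M i); apply: ordXU. Qed.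

Lemma ord_shear M n p : ord (grade M) n p -> ord (grade M) n (shear p).
Proof.
have le_n : (n <= M + (n - M))%N by lia.
move=> hp; apply: suppD; apply: (ord_le le_n); apply: ordM.
- exact: ord_xi.
- exact: ord_dxi.
- exact: ord_xi.
- exact: ord_dxi.
Qed.

Lemma ubord_shear k v p : ubord level k v p -> ubord level k.+1 v (shear p).
Proof.
have level_l i : level (lshift m i) = nth 0%N [:: 2; 1; 0]%N i by rewrite /level mkwt_l.
move=> hp; have hx (i : 'I_3) : ubord level 0 (nth 0%N [:: 2; 1; 0]%N i) (xi R m i).
  by apply: suppX; rewrite wtU level_l.
apply: suppD.
  have := ubordM (hx iy) (ubord_mderiv (i := lshift m ix) hp); rewrite level_l /=.
  by apply: suppW => mo /=; lia.
have := ubordM (hx iz) (ubord_mderiv (i := lshift m iy) hp); rewrite level_l /=.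
by apply: suppW => mo /=; lia.
Qed.

Lemma ubord_dxi k v (i : 'I_3) p : ubord level k v p -> ubord level (k + (2 - i)) v (dxi i p).
Proof.
have level_l : level (lshift m i) = (2 - i)%N.
  by rewrite /level mkwt_l; move: i; apply: ord3_ind.
by move=> /(@ubord_mderiv _ _ _ (lshift m i)); rewrite level_l.
Qed.

Section Perturbation.
Variable B : {linear P -> P}.
Variable M : nat.
Hypothesis ordB : forall n p, ord (grade M) n p -> ord (grade M) n (B p).
Hypothesis levelB : forall k v p, ubord level k v p -> ubord level k.+1 v (B p).
Hypothesis levelBS : forall k v p, ubord level k v p -> ubord level k.+2 v (B p - shear p).

(** Finite Neumann iteration: the exact solution for [shear] leaves an error under [B] whose level
    bound is one lower, and a negative bound forces the error to be 0. The grade order is kept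
    throughout. *)
Lemma div_op_surj n s : ord (grade M) n s ->
  exists h, ord (grade M) (M + n) h /\ div_op B h = s.
Proof.
suff solve : forall d k v s, (v < k + 2 + d)%N -> ubord level (k + 2) v s ->
    ord (grade M) n s -> exists h, ord (grade M) (M + n) h /\ div_op B h = s.
  (* The sum of the levels is a crude bound for their maximum; the 2 matches the initial index
     [k + 2] at [k = 0]. *)
  move=> hs; pose v := (2 + \sum_(mo <- msupp s) wt level mo)%N.
  apply: (solve v.+1 0%N v) => //; first by lia.
  move=> mo; rewrite -mcoeff_msupp => inS.
  by rewrite add0n leq_add2l (big_rem mo) //= leq_addr.
elim=> [|d IHd] k v {}s lt_v hs os.
  have -> : s = 0 by apply: (supp_pred0 _ hs) => mo; lia.
  exists 0; split; first exact: supp0.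
  by rewrite /div_op !raddf0 !dxi_cst0 !addr0.
have [h0 [Eh h0_supp]] := div_op_shear_surj s.
(* The level is [2 * phase_deg - line_deg], so it is two higher in [h0] than in the source. *)
have lev_h0 : ubord level k v h0.
  move=> mo /h0_supp[mo' [/hs hmo' Eh' El' _]]; apply: leq_trans hmo'.
  rewrite !wt_level; move: Eh' El'; rewrite /phase_deg /line_deg; lia.
have ord_h0 : ord (grade M) (M + n) h0.
  move=> mo /h0_supp[mo' [/os omo' Eh' _ Ee]].
  have ES : (\sum_(j < m) lexp mo j = \sum_(j < m) lexp mo' j)%N.
    by apply: eq_bigr => j _; rewrite Ee.
  by move: omo'; rewrite !wt_grade Eh' ES mulnS -addnA leq_add2l.
(* Every term of the error contains [B - shear], which lowers the level by two instead of one. *)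
have ES : s - div_op B h0 =
    - (dxi iy (B h0 - shear h0) + dxi iz ((B (B h0) - shear (B h0)) + shear (B h0 - shear h0))).
  have shB p q : shear (p - q) = shear p - shear q by rewrite /shear !dxiB; ring.
  rewrite -{1}Eh /div_op; move: (@shear R m) shB => S shB; rewrite !(dxiB, dxiD, shB); ring.
have [|||h [oh Eh1]] := IHd k.+1 v (s - div_op B h0).
- by lia.
- rewrite ES; apply/suppN/suppD.
    by have := ubord_dxi (i := iy) (levelBS lev_h0); apply: ubord_le; rewrite /=; lia.
  have h1 := levelBS (levelB lev_h0); have h2 := ubord_shear (levelBS lev_h0).
  by have := ubord_dxi (i := iz) (suppD h1 h2); apply: ubord_le; rewrite /=; lia.
- apply: suppB => //; apply: suppD; first apply: suppD; apply: ord_dxiK => //.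
    exact: ordB.
  by apply/ordB/ordB.
exists (h0 + h); split; first exact: suppD.
have -> : div_op B (h0 + h) = div_op B h0 + div_op B h.
  by rewrite /div_op !raddfD /= !dxiD; ring.
by rewrite Eh1 addrC subrK.
Qed.

End Perturbation.

End Weights.

(** * Substitution for the phase variables: composition, chain rule, order estimates *)

Lemma mpoly_alg_ind (R : nzRingType) n (Q : {mpoly R[n]} -> Prop) :
    (forall c, Q c%:MP) -> (forall p q, Q p -> Q q -> Q (p + q)) ->
    (forall c p, Q p -> Q (c *: p)) ->
    (forall i p, Q p -> Q ('X_i * p)) -> forall p, Q p.
Proof.
move=> QC QD QZ QX; have QM mo : Q 'X_[mo].
  by elim/mnm_ind: mo => [|i mo Qmo]; rewrite ?mpolyX0 -?mpolyC1 // mpolyXD; apply: QX.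
apply: mpolyind => [|c mo p _ _ Qp]; first by rewrite -mpolyC0.
exact/QD/Qp/QZ.
Qed.

Section Subst.
Variables (R : realFieldType) (m : nat).
Local Notation P := {mpoly R[3 + m]}.
Local Notation mon := 'X_{1..3 + m}.
Implicit Types (p q s : P) (mo : mon) (phi psi : 'I_3 -> P).

Lemma substD phi : {morph subst phi : p q / p + q}.
Proof. exact: comp_mpolyD. Qed.

Lemma substB phi : {morph subst phi : p q / p - q}.
Proof. exact: comp_mpolyB. Qed.

Lemma substM phi : {morph subst phi : p q / p * q}.
Proof. by move=> p q; rewrite /subst rmorphM. Qed.

Lemma substZ phi c p : subst phi (c *: p) = c *: subst phi p.
Proof. exact: comp_mpolyZ. Qed.

Lemma substC phi c : subst phi c%:MP = c%:MP.
Proof. exact: comp_mpolyC. Qed.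

Lemma subst0 phi : subst phi 0 = 0.
Proof. exact: comp_mpoly0. Qed.

Lemma subst1 phi : subst phi 1 = 1.
Proof. exact: comp_mpoly1. Qed.

Lemma subst_sum phi (I : Type) (r : seq I) (F : I -> P) :
  subst phi (\sum_(i <- r) F i) = \sum_(i <- r) subst phi (F i).
Proof. by rewrite /subst raddf_sum. Qed.

Lemma substXU phi k : subst phi 'X_k = match split k with inl i => phi i | inr _ => 'X_k end.
Proof. by rewrite /subst comp_mpolyXU -tnth_nth tnth_mktuple. Qed.

Lemma subst_xi phi i : subst phi (xi R m i) = phi i.
Proof. by rewrite substXU -[lshift m i]/(unsplit (inl i)) unsplitK. Qed.

Lemma subst_lam phi j : subst phi 'X_(rshift 3 j) = 'X_(rshift 3 j).
Proof. by rewrite substXU -[rshift 3 j]/(unsplit (inr j)) unsplitK. Qed.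

Lemma subst_comp phi psi p : subst phi (subst psi p) = subst (fun i => subst phi (psi i)) p.
Proof.
elim/mpoly_alg_ind: p => [c|p q Ep Eq|c p Ep|k p Ep].
- by rewrite !substC.
- by rewrite !substD Ep Eq.
- by rewrite !substZ Ep.
rewrite 3!substM Ep; apply: (congr1 (fun a => a * _)).
by elim/split_ind: k => i; rewrite ?subst_xi ?subst_lam.
Qed.

Lemma subst_ext phi psi p : phi =1 psi -> subst phi p = subst psi p.
Proof.
move=> E; elim/mpoly_alg_ind: p => [c|p q Ep Eq|c p Ep|k p Ep].
- by rewrite !substC.
- by rewrite !substD Ep Eq.
- by rewrite !substZ Ep.
rewrite 2!substM Ep; apply: (congr1 (fun a => a * _)).
by elim/split_ind: k => i; rewrite ?subst_xi ?subst_lam.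
Qed.

Lemma subst_id p : subst (@xi R m) p = p.
Proof.
elim/mpoly_alg_ind: p => [c|p q Ep Eq|c p Ep|k p Ep].
- by rewrite !substC.
- by rewrite !substD Ep Eq.
- by rewrite !substZ Ep.
rewrite substM Ep; congr (_ * _).
by elim/split_ind: k => i; rewrite ?subst_xi ?subst_lam.
Qed.

Lemma dxi_subst j phi p :
  dxi j (subst phi p) = \sum_(l < 3) subst phi (dxi l p) * dxi j (phi l).
Proof.
elim/mpoly_alg_ind: p => [c|p q Ep Eq|c p Ep|k p Ep].
- by rewrite substC dxiC big1 // => l _; rewrite dxiC subst0 mul0r.
- rewrite substD dxiD Ep Eq -big_split /=.
  by apply: eq_bigr => l _; rewrite dxiD substD mulrDl.
- rewrite substZ dxiZ Ep scaler_sumr; apply: eq_bigr => l _.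
  by rewrite dxiZ substZ scalerAl.
rewrite substM dxiM Ep.
rewrite [RHS](eq_bigr (fun l => subst phi (dxi l 'X_k) * dxi j (phi l) * subst phi p
   + subst phi 'X_k * (subst phi (dxi l p) * dxi j (phi l)))); last first.
  by move=> l _; rewrite dxiM substD 2!substM mulrDl mulrAC mulrA.
rewrite big_split /= -big_distrl -big_distrr /=; congr (_ * _ + _).
elim/split_ind: k => i; last first.
  rewrite subst_lam dxiXU eq_lrshift big1 // => l _.
  by rewrite dxiXU eq_lrshift subst0 mul0r.
rewrite subst_xi (bigD1 i) //= dxi_xi eqxx subst1 mul1r big1 ?addr0 // => l ne_l.
by rewrite dxi_xi eq_sym (negPf ne_l) subst0 mul0r.
Qed.

Variable M : nat.
Local Notation ordg n := (ord (grade M) n).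

Lemma ord_subst phi n p : (forall i, ordg M (phi i)) -> ordg n p -> ordg n (subst phi p).
Proof.
move=> hphi; apply: supp_linear => [c q r|mo]; first by rewrite substD substZ.
suff: ordg (wt (grade M) mo) (subst phi 'X_[mo]) by move=> h /ord_le; apply.
elim/mnm_ind: mo => [|k mo IHmo]; first by rewrite wt0; apply: ord_0.
rewrite mpolyXD substM wtD wtU; apply: ordM IHmo.
by elim/split_ind: k => i; rewrite ?subst_xi ?grade_xi // subst_lam; apply: ordXU.
Qed.

(** A Lipschitz estimate: changing the substituted functions by relative order [t] changes the
    result by relative order [t]. *)
Lemma ord_substB phi psi n t p :
    (forall i, ordg M (phi i)) -> (forall i, ordg M (psi i)) ->
    (forall i, ordg (M + t) (phi i - psi i)) ->
  ordg n p -> ordg (n + t) (subst phi p - subst psi p).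
Proof.
move=> hphi hpsi hB; apply: (supp_linear (f := fun p => subst phi p - subst psi p)).
  move=> c q r; rewrite 2!substD 2!substZ scalerBr.
  by rewrite opprD addrACA.
move=> mo hmo; suff: ordg (wt (grade M) mo + t) (subst phi 'X_[mo] - subst psi 'X_[mo]).
  by apply: ord_le; rewrite leq_add2r.
elim/mnm_ind: mo {hmo} => [|k mo IHmo].
  by rewrite mpolyX0 !subst1 subrr; apply: supp0.
rewrite mpolyXD !substM wtD wtU.
set a := subst phi 'X_k; set b := subst psi 'X_k.
set c := subst phi 'X_[mo]; set d := subst psi 'X_[mo].
(* Telescoping, so that each term contains one difference. *)
have -> : a * c - b * d = a * (c - d) + (a - b) * d by rewrite mulrBr mulrBl addrA subrK.
have ha : ordg (grade M k) a.
  rewrite /a; elim/split_ind: (k) => i; rewrite ?subst_xi ?grade_xi //.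
  by rewrite subst_lam; apply: ordXU.
have hab : ordg (grade M k + t) (a - b).
  rewrite /a /b; elim/split_ind: (k) => i; rewrite ?subst_xi ?grade_xi //.
  by rewrite !subst_lam subrr; apply: supp0.
have hd : ordg (wt (grade M) mo) d by apply: ord_subst => //; apply: suppX.
by apply: suppD; [rewrite -addnA; apply: ordM | rewrite addnAC; apply: ordM].
Qed.

End Subst.

(** * The homological equations for fields and for maps *)

Section Homological.
Variables (R : realFieldType) (m : nat).
Local Notation P := {mpoly R[3 + m]}.
Local Notation mon := 'X_{1..3 + m}.
Local Notation x := (xi R m ix).
Local Notation y := (xi R m iy).
Local Notation z := (xi R m iz).
Local Notation dx := (@dxi R m ix).
Local Notation dy := (@dxi R m iy).
Local Notation dz := (@dxi R m iz).
Implicit Types (p q s : P) (mo : mon) (h F : 'I_3 -> P).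

Definition vec3 (a b c : P) (i : 'I_3) : P := nth 0 [:: a; b; c] i.

Definition Nmul h (i : 'I_3) : P := \sum_(j < 3) Nmat R i j *: h j.
Definition Jmul h (i : 'I_3) : P := \sum_(j < 3) Jmat R i j *: h j.

Lemma NmulE h : Nmul h =1 vec3 (h iy) (h iz) 0.
Proof. by apply: ord3_ind; rewrite /Nmul big_ord3 !mxE /= !(scale0r, scale1r, addr0, add0r). Qed.

Lemma JmulE h : Jmul h =1 vec3 (h ix + h iy) (h iy + h iz) (h iz).
Proof.
by apply: ord3_ind; rewrite /Jmul big_ord3 !mxE /= !(scale0r, scale1r, addr0, add0r).
Qed.

Definition Jinv h := vec3 (h ix - h iy + h iz) (h iy - h iz) (h iz).

Definition shift : P -> P := subst (Jmul (@xi R m)).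
Definition unshift : P -> P := subst (Jinv (@xi R m)).
(** The counterpart of [shear] for maps; with respect to [level], [shear] is its leading part. *)
Definition dshift p := shift p - p.

Lemma shear_is_linear : linear (@shear R m).
Proof. by move=> c p q; rewrite /shear !dxiD !dxiZ scalerDr !scalerAr; ring. Qed.

HB.instance Definition _ := GRing.isLinear.Build R P P *:%R (@shear R m) shear_is_linear.

Lemma shift_is_linear : linear shift.
Proof. by move=> c p q; rewrite /shift substD substZ. Qed.

HB.instance Definition _ := GRing.isLinear.Build R P P *:%R shift shift_is_linear.

Lemma dshift_is_linear : linear dshift.
Proof. by move=> c p q; rewrite /dshift linearP /= scalerBr; ring. Qed.

HB.instance Definition _ := GRing.isLinear.Build R P P *:%R dshift dshift_is_linear.

Lemma unshiftK p : shift (unshift p) = p.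
Proof.
rewrite /shift /unshift subst_comp -[RHS]subst_id; apply: subst_ext.
by apply: ord3_ind; rewrite /Jinv /vec3 /= !(substB, substD, subst_xi) !JmulE /vec3 /=; ring.
Qed.

Lemma dx_shift p : dx (shift p) = shift (dx p).
Proof.
rewrite /shift dxi_subst big_ord3 !JmulE /vec3 /= !dxiD !dxi_xi /=.
by rewrite !(mulr0, addr0, mulr1).
Qed.

Lemma dy_shift p : dy (shift p) = shift (dx p + dy p).
Proof.
rewrite /shift dxi_subst big_ord3 !JmulE /vec3 /= !dxiD !dxi_xi /= substD.
by rewrite !(mulr0, addr0, add0r, mulr1).
Qed.

Lemma dz_shift p : dz (shift p) = shift (dy p + dz p).
Proof.
rewrite /shift dxi_subst big_ord3 !JmulE /vec3 /= !dxiD !dxi_xi /= substD.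
by rewrite !(mulr0, addr0, add0r, mulr1).
Qed.

Lemma dx_shear p : dx (shear p) = shear (dx p).
Proof. by rewrite /shear dxiD !dxiM !dxi_xi /= (dxi_comm ix iy); ring. Qed.

Lemma dy_shear p : dy (shear p) = shear (dy p) + dx p.
Proof. by rewrite /shear dxiD !dxiM !dxi_xi /= (dxi_comm iy ix); ring. Qed.

Lemma dz_shear p : dz (shear p) = shear (dz p) + dy p.
Proof.
by rewrite /shear dxiD !dxiM !dxi_xi /= (dxi_comm iz ix) (dxi_comm iz iy); ring.
Qed.

(** [shift] is multiplicative, [shear] is a derivation, and [shift = 1 + shear] on variables. The
    three bounds feed each other in the product rule, hence the joint induction. *)
Lemma ubord_shift_mon mo (X := 'X_[mo] : P) (v := wt (@level m) mo) :
  [/\ ubord (@level m) 0 v (shift X), ubord (@level m) 1 v (dshift X)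
    & ubord (@level m) 2 v (dshift X - shear X)].
Proof.
rewrite {}/X {}/v; elim/mnm_ind: mo => [|k mo [h0 h1 h2]].
  rewrite wt0 mpolyX0 /dshift /shift subst1 subrr /shear !dxi_cst1 !mulr0 addr0 subr0.
  by split; [rewrite -mpolyX0; apply: suppX; rewrite wt0 | exact: supp0 | exact: supp0].
have [e0 e1] : ubord (@level m) 0 (level k) ('X_k : P)
    /\ ubord (@level m) 1 (level k) (shear 'X_k : P).
  have e0 : ubord (@level m) 0 (level k) ('X_k : P) by apply: suppX; rewrite add0n wtU.
  by split=> //; apply: ubord_shear.
have Ek : shift 'X_k = 'X_k + shear 'X_k.
  rewrite /shear /shift; elim/split_ind: k {e0 e1} => i.
    rewrite -[mpolyX _ _]/(xi R m i) subst_xi !dxi_xi JmulE.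
    by move: i; apply: ord3_ind; rewrite /vec3 /=; ring.
  by rewrite subst_lam !dxiXU !eq_lrshift /=; ring.
have eM : shift ('X_k * 'X_[mo]) = shift 'X_k * shift 'X_[mo] by rewrite /shift substM.
have sM : shear ('X_k * 'X_[mo]) = shear 'X_k * 'X_[mo] + 'X_k * shear 'X_[mo] :> P.
  by rewrite /shear !dxiM; ring.
rewrite mpolyXD wtD wtU; split.
- by rewrite eM Ek; apply: (ubordM (k := 0) _ h0); apply/suppD/(ubord_le _ e1).
- have -> : dshift ('X_k * 'X_[mo]) = 'X_k * dshift 'X_[mo] + shear 'X_k * shift 'X_[mo].
    by rewrite /dshift eM Ek; ring.
  apply: suppD; first exact: (ubordM e0 h1).
  exact: (ubordM e1 h0).
have -> : dshift ('X_k * 'X_[mo]) - shear ('X_k * 'X_[mo]) =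
    'X_k * (dshift 'X_[mo] - shear 'X_[mo]) + shear 'X_k * dshift 'X_[mo].
  by rewrite sM /dshift eM Ek; ring.
apply: suppD; first exact: (ubordM e0 h2).
exact: (ubordM e1 h1).
Qed.

Lemma ubord_dshift k v p : ubord (@level m) k v p -> ubord (@level m) k.+1 v (dshift p).
Proof.
apply: supp_linear; first exact: dshift_is_linear.
move=> mo hmo; have [_ + _] := ubord_shift_mon mo.
by apply: suppW => mo' /=; lia.
Qed.

Lemma ubord_dshiftB k v p :
  ubord (@level m) k v p -> ubord (@level m) k.+2 v (dshift p - shear p).
Proof.
apply: (supp_linear (f := fun p => dshift p - shear p)).
  by move=> c q r; rewrite dshift_is_linear shear_is_linear (scalerBr c (dshift q)); ring.
move=> mo hmo; have [_ _] := ubord_shift_mon mo.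
by apply: suppW => mo' /=; lia.
Qed.

Variables (M : nat).
Local Notation ordg := (ord (@grade m M)).

Lemma ord_Jmul n h i : (forall j, ordg n (h j)) -> ordg n (Jmul h i).
Proof. by move=> hh; apply: supp_sum => j _; apply: suppZ; apply: hh. Qed.

Lemma ord_Jinv n h i : (forall j, ordg n (h j)) -> ordg n (Jinv h i).
Proof.
move=> hh; move: i; apply: ord3_ind; rewrite /Jinv /vec3 /=; last exact: hh.
  by apply: suppD; [apply: suppB|]; apply: hh.
by apply: suppB; apply: hh.
Qed.

Lemma ord_shift n p : ordg n p -> ordg n (shift p).
Proof. by apply: ord_subst => i; apply/ord_Jmul/ord_xi. Qed.

Lemma ord_unshift n p : ordg n p -> ordg n (unshift p).
Proof. by apply: ord_subst => i; apply/ord_Jinv/ord_xi. Qed.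

Lemma ord_dshift n p : ordg n p -> ordg n (dshift p).
Proof. by move=> hp; apply: suppB => //; apply: ord_shift. Qed.

Definition zfree p := forall mo, p@_mo != 0 -> xexp iz mo = 0%N.

Lemma zfree_dz p : zfree p -> dz p = 0.
Proof.
move=> hp; apply/mpolyP => mo; rewrite mcoeff_dxi mcoeff0.
apply/eqP/negPn/negP; rewrite mulf_eq0 negb_or => /andP[_ /hp].
by rewrite xexpU.
Qed.

(** A monomial containing z survives [dz] in characteristic 0, so its weight is bounded by the order
    of [dz g]; dropping such monomials costs one order higher. *)
Lemma zfree_part n g : ordg (M + n) g -> ordg n.+1 (dz g) ->
  exists g1, [/\ ordg (M + n) g1, zfree g1 & ordg (M + n).+1 (g - g1)].
Proof.
move=> og odg; exists (filt (fun mo => xexp iz mo == 0%N) g); split.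
- by move=> mo /(supp_filt og) /andP[].
- by move=> mo; rewrite mcoeff_filt; case: ifP => [/eqP //|_]; rewrite eqxx.
move=> mo; rewrite mcoeffB mcoeff_filt; case: ifP; rewrite ?subrr ?eqxx // => nz0.
rewrite subr0 => nz; have le_z : (U_(lshift m iz) <= mo)%MM by rewrite lep1mP -/(xexp iz mo) nz0.
move: nz; rewrite -(submK le_z) addmC => nz.
have {nz}/odg : (dz g)@_(mo - U_(lshift m iz)) != 0 by rewrite mcoeff_dxi mulf_neq0 ?pnatr_eq0.
by rewrite wtD wtU grade_xi -addnS leq_add2l.
Qed.

Lemma ord_unshiftP n p : ordg n (shift p) -> ordg n p.
Proof.
suff -> : p = unshift (shift p) by rewrite unshiftK; apply: ord_unshift.
rewrite /shift /unshift subst_comp -[LHS]subst_id; apply: subst_ext.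
by apply: ord3_ind; rewrite JmulE /vec3 /= ?substD !subst_xi /Jinv /vec3 /=; ring.
Qed.

(** Rows one and two define [h2] and [h3], row three defines [g], and the choice of [h1] makes
    [div h = s] exact. Only the replacement of [g] by its part without z leaves an error. *)
Lemma solve_field n F s :
    (forall i, ordg (M + n) (F i)) -> ordg n s -> ordg n.+1 (div F - shear s) ->
  exists h g, [/\ forall i, ordg (M + n) (h i), ordg (M + n) g, zfree g,
    ordg n.+1 (div h - s) &
    forall i, ordg (M + n).+1 (F i - (shear (h i) - Nmul h i) - (i == iz)%:R * g)].
Proof.
move=> oF os compat.
have [||||h1 [oh1 Eh1]] := @div_op_surj R m (@shear R m) M _ _ _ n
    (s + dy (F ix) + dz (shear (F ix)) + dz (F iy)).
- by move=> *; apply: ord_shear.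
- by move=> *; apply: ubord_shear.
- by move=> *; rewrite subrr; apply: supp0.
- apply: suppD; last exact/ord_dxiK/oF.
  apply: suppD; last exact/ord_dxiK/ord_shear/oF.
  by apply: suppD; last exact/ord_dxiK/oF.
pose h2 := shear h1 - F ix; pose h3 := shear h2 - F iy; pose g := F iz - shear h3.
have oh2 : ordg (M + n) h2 by apply: suppB; [apply: ord_shear | apply: oF].
have oh3 : ordg (M + n) h3 by apply: suppB; [apply: ord_shear | apply: oF].
have og : ordg (M + n) g by apply: suppB; [apply: oF | apply: ord_shear].
have shB p q : shear (p - q) = shear p - shear q :> P by exact: raddfB.
have Ediv : div (vec3 h1 h2 h3) = s.
  move: Eh1; rewrite /div_op /div big_ord3 /vec3 /= /h3 /h2.
  move: (@shear R m) shB => S shB; rewrite !(dxiB, shB) => E1.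
  have -> : s = dx h1 + dy (S h1) + dz (S (S h1)) - (dy (F ix) + dz (S (F ix)) + dz (F iy)).
    by rewrite E1; ring.
  by ring.
(* Differentiating the three rows: the commutators of [dy] and [dz] with [shear] cancel the
   divergence of [N h]. *)
have Edz : dz g = div F - shear s.
  have E1 : F ix = shear h1 - h2 by rewrite /h2; ring.
  have E2 : F iy = shear h2 - h3 by rewrite /h3; ring.
  have E3 : F iz = g + shear h3 by rewrite /g; ring.
  clearbody g h3 h2.
  rewrite -Ediv /div !big_ord3 E1 E2 E3 /vec3 /= !dxiB dx_shear dy_shear (dxiD iz) dz_shear.
  have shD p q : shear (p + q) = shear p + shear q :> P by exact: raddfD.
  move: (@shear R m) shD => S shD; rewrite !shD; ring.
have [|g1 [og1 zg1 ogg1]] := zfree_part og; first by rewrite Edz.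
exists (vec3 h1 h2 h3), g1; split=> //.
- exact: ord3_ind.
- by rewrite Ediv subrr; apply: supp0.
apply: ord3_ind; rewrite NmulE /vec3 /= ?mul0r ?subr0.
- by rewrite /h2 (_ : _ - _ = 0); [apply: supp0 | ring].
- by rewrite /h3 (_ : _ - _ = 0); [apply: supp0 | ring].
by rewrite mul1r -/g.
Qed.

(** As for fields, with [dshift] for [shear]; here [div h = s] holds only up to [dz g], which is of
    higher order. *)
Lemma solve_map n F s :
    (forall i, ordg (M + n) (F i)) -> ordg n s ->
    ordg n.+1 (div (Jinv F) - dshift s) ->
  exists h g, [/\ forall i, ordg (M + n) (h i), ordg (M + n) g, zfree g,
    ordg n.+1 (div h - s) &
    forall i, ordg (M + n).+1 (F i - (shift (h i) - Jmul h i)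
                                - Jmul (fun j => (j == iz)%:R * g) i)].
Proof.
move=> oF os compat.
have [||||h1 [oh1 Eh1]] := @div_op_surj R m dshift M _ _ _ n
    (s + dy (F ix) + dz (dshift (F ix)) + dz (F iy)).
- exact: ord_dshift.
- exact: ubord_dshift.
- exact: ubord_dshiftB.
- apply: suppD; last exact/ord_dxiK/oF.
  apply: suppD; last exact/ord_dxiK/ord_dshift/oF.
  by apply: suppD; last exact/ord_dxiK/oF.
(* Since [J] sends [g e_3] to [(0, g, g)], row two gives [h3 = k3 + g]; row three then reads
   [shift g = F iz - dshift k3]. *)
pose h2 := dshift h1 - F ix; pose k3 := dshift h2 - F iy.
pose g := unshift (F iz - dshift k3); pose h3 := k3 + g.
have oh2 : ordg (M + n) h2 by apply: suppB; [apply: ord_dshift | apply: oF].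
have ok3 : ordg (M + n) k3 by apply: suppB; [apply: ord_dshift | apply: oF].
have og : ordg (M + n) g.
  by apply/ord_unshift/suppB; [apply: oF | apply: ord_dshift].
have oh3 : ordg (M + n) h3 by apply: suppD.
have shB p q : dshift (p - q) = dshift p - dshift q :> P by exact: raddfB.
have shD p q : dshift (p + q) = dshift p + dshift q :> P by exact: raddfD.
have Ediv : div (vec3 h1 h2 h3) = s + dz g.
  clearbody g; move: Eh1; rewrite /div_op /div big_ord3 /vec3 /= /h3 /k3 /h2.
  move: dshift shB => S shB.
  rewrite !(dxiB, shB, dxiD) => E1.
  have -> : s = dx h1 + dy (S h1) + dz (S (S h1)) - (dy (F ix) + dz (S (F ix)) + dz (F iy)).
    by rewrite E1; ring.
  by ring.
have E1 : F ix = dshift h1 - h2 by rewrite /h2; ring.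
have E2 : F iy = dshift h2 - h3 + g by rewrite /h3 /k3; ring.
have E3 : F iz = dshift h3 + g.
  rewrite /h3 shD -addrA -[_ + g]/(dshift g + g) {2}/dshift subrK unshiftK; ring.
have shiftE p : shift p = dshift p + p by rewrite /dshift subrK.
(* Applying [Jinv] to the rows first makes the commutators of the derivatives with [dshift]
   cancel. *)
have Edz : div (Jinv F) - dshift s = shift (dz g).
  have -> : dshift s = dshift (div (vec3 h1 h2 h3)) - dshift (dz g) by rewrite Ediv shD; ring.
  have dxS p : dx (dshift p) = dshift (dx p) by rewrite /dshift dxiB dx_shift.
  have dyS p : dy (dshift p) = dshift (dx p) + dx p + dshift (dy p).
    by rewrite /dshift dxiB dy_shift linearD /=; ring.
  have dzS p : dz (dshift p) = dshift (dy p) + dy p + dshift (dz p).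
    by rewrite /dshift dxiB dz_shift linearD /=; ring.
  clearbody g h3 k3 h2; rewrite shiftE /div !big_ord3 /Jinv E1 E2 E3 /vec3 /=.
  move: dshift shB shD dxS dyS dzS => S shB shD dxS dyS dzS.
  by rewrite !(dxiB, dxiD, dxS, dyS, dzS, shB, shD); ring.
have [|g1 [og1 zg1 ogg1]] := zfree_part og.
  by apply: ord_unshiftP; rewrite -Edz.
exists (vec3 h1 h2 h3), g1; split=> //.
- exact: ord3_ind.
- rewrite Ediv addrC addKr; apply: ord_unshiftP; by rewrite -Edz.
apply: ord3_ind; rewrite !JmulE /vec3 /= ?mul0r ?mul1r ?shiftE ?E1 ?E2 ?E3.
- by rewrite (_ : _ - _ = 0); [apply: supp0 | ring].
- by rewrite (_ : _ - _ = g - g1); last ring.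
by rewrite (_ : _ - _ = g - g1); last ring.
Qed.

End Homological.

(** * Cofactors and Jacobian determinants *)

Definition next3 (i : 'I_3) : 'I_3 := nth ix [:: iy; iz; ix] i.

(** The signed cofactor: cyclic indices absorb the sign. *)
Definition cof3 (K : comNzRingType) (A : 'M[K]_3) (i j : 'I_3) : K :=
  A (next3 i) (next3 j) * A (next3 (next3 i)) (next3 (next3 j))
  - A (next3 i) (next3 (next3 j)) * A (next3 (next3 i)) (next3 j).

Lemma det3_cof (K : comNzRingType) (A : 'M[K]_3) :
  \det A = A ix ix * cof3 A ix ix + A ix iy * cof3 A ix iy + A ix iz * cof3 A ix iz.
Proof.
rewrite (expand_det_row _ ix) big_ord3 /cofactor !(expand_det_row _ ord0) !big_ord_recl !big_ord0.
rewrite /cofactor !det_mx11 !mxE /cof3 /next3 /=.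
pose a i j := A (inord i) (inord j).
have aE i j : A i j = a i j by rewrite /a !inord_val.
by rewrite !aE /= /bump /= !(addn0, expr0, addn1, add0n, add1n) /=; ring.
Qed.

Lemma cof3_row (K : comNzRingType) (A : 'M[K]_3) i l :
  \sum_(j < 3) cof3 A i j * A l j = (i == l)%:R * \det A.
Proof.
rewrite det3_cof big_ord3 /cof3; move: i l; apply: ord3_ind; apply: ord3_ind => /=;
by rewrite /next3 /=; ring.
Qed.

Lemma cof3_col (K : comNzRingType) (A : 'M[K]_3) j l :
  \sum_(i < 3) cof3 A i j * A i l = (j == l)%:R * \det A.
Proof.
rewrite det3_cof big_ord3 /cof3; move: j l; apply: ord3_ind; apply: ord3_ind => /=;
by rewrite /next3 /=; ring.
Qed.

Section Jacobian.
Variables (R : realFieldType) (m : nat).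
Local Notation P := {mpoly R[3 + m]}.
Implicit Types (p q : P) (u v w e phi : 'I_3 -> P).

Lemma jacE u i j : jac u i j = dxi j (u i).
Proof. by rewrite mxE. Qed.

Lemma dxi_sum j (I : Type) (r : seq I) (F : I -> P) :
  dxi j (\sum_(i <- r) F i) = \sum_(i <- r) dxi j (F i).
Proof. exact: raddf_sum. Qed.

(** Jacobi's formula. *)
Lemma dxi_det3 l (A : 'M[P]_3) :
  dxi l (\det A) = \sum_(i < 3) \sum_(j < 3) cof3 A i j * dxi l (A i j).
Proof.
rewrite det3_cof !big_ord3 /cof3 /next3 /= !(dxiD, dxiN, dxiM); ring.
Qed.

(** After the product and chain rules, the adjugate identities turn two of the three sums into
    multiples of [div v] and [div w], hence into 0. *)
Lemma div_pullback phi v w : div v = 0 -> div w = 0 ->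
  \sum_(i < 3) \sum_(j < 3) cof3 (jac phi) i j
      * dxi j (subst phi (v i) - \sum_(l < 3) jac phi i l * w l)
  = - \sum_(l < 3) w l * dxi l (\det (jac phi)).
Proof.
move=> v0 w0.
have E i j : dxi j (subst phi (v i) - \sum_(l < 3) jac phi i l * w l) =
    \sum_(l < 3) subst phi (dxi l (v i)) * jac phi l j
    - \sum_(l < 3) w l * dxi l (jac phi i j) - \sum_(l < 3) jac phi i l * dxi j (w l).
  rewrite dxiB dxi_subst dxi_sum -addrA -opprD -big_split /=; congr (_ - _).
    by apply: eq_bigr => l _; rewrite jacE.
  apply: eq_bigr => l _; rewrite dxiM !jacE (dxi_comm j l); ring.
under eq_bigr => i _ do under eq_bigr => j _ do rewrite E 2!mulrDr 2!mulrN.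
under eq_bigr => i _ do rewrite 2!big_split /= 2!sumrN.
rewrite 2!big_split /= 2!sumrN.
set S1 := (X in X - _ - _); set S2 := (X in _ - X - _); set S3 := (X in _ - X).
have -> : S1 = 0.
  rewrite -[RHS](mul0r (\det (jac phi))) -(subst0 phi) -v0 /div subst_sum big_distrl /=.
  apply: eq_bigr => i _.
  under eq_bigr => j _ do rewrite big_distrr /=.
  rewrite exchange_big /=.
  rewrite (eq_bigr (fun l => subst phi (dxi l (v i)) * ((i == l)%:R * \det (jac phi)))).
    rewrite (bigD1 i) //= eqxx mul1r big1 ?addr0 // => l ne.
    by rewrite eq_sym (negPf ne) mul0r mulr0.
  move=> l _; rewrite -cof3_row big_distrr /=; apply: eq_bigr => j _; ring.
have -> : S3 = 0.
  rewrite -[RHS](mul0r (\det (jac phi))) -w0 /div big_distrl /= /S3 exchange_big /=.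
  apply: eq_bigr => j _.
  under eq_bigr => i _ do rewrite big_distrr /=.
  rewrite exchange_big /= (eq_bigr (fun l => dxi j (w l) * ((j == l)%:R * \det (jac phi)))).
    rewrite (bigD1 j) //= eqxx mul1r big1 ?addr0 // => l ne.
    by rewrite eq_sym (negPf ne) mul0r mulr0.
  move=> l _; rewrite -cof3_col big_distrr /=; apply: eq_bigr => i _; ring.
(* The remaining sum, with second derivatives of [phi], is Jacobi's formula along [w]. *)
rewrite sub0r subr0; congr (- _); rewrite /S2.
under [LHS]eq_bigr => i _ do under eq_bigr => j _ do rewrite big_distrr /=.
under [LHS]eq_bigr => i _ do rewrite exchange_big /=.
rewrite exchange_big /=; apply: eq_bigr => l _.
rewrite dxi_det3 big_distrr /=; apply: eq_bigr => i _.
by rewrite big_distrr /=; apply: eq_bigr => j _; ring.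
Qed.

Lemma det_jac_subst phi u :
  \det (jac (fun i => subst phi (u i))) = subst phi (\det (jac u)) * \det (jac phi).
Proof.
rewrite {2}/subst -det_map_mx -det_mulmx; congr (\det _); apply/matrixP => i j.
by rewrite !mxE dxi_subst; apply: eq_bigr => l _; rewrite !mxE.
Qed.

Lemma det_jac_Jinv u : \det (jac (Jinv u)) = \det (jac u).
Proof.
by rewrite !det3_cof /cof3 /next3 /= !jacE /Jinv /vec3 /= !(dxiB, dxiD); ring.
Qed.

Lemma det_jac_nf (g : P) : zfree g ->
  \det (jac (fun i => xi R m i + (i == iz)%:R * g)) = 1.
Proof.
move=> /zfree_dz g0.
rewrite !det3_cof /cof3 /next3 /= !jacE /=.
by rewrite !(dxiD, dxiM, dxi_xi, dxi_cst0, dxi_cst1) /= g0; ring.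
Qed.

Variable M : nat.
Local Notation ordg := (ord (@grade m M)).

Lemma ordMl n p q : ordg n p -> ordg n (p * q).
Proof. by move=> hp; rewrite -[n]addn0; exact: ordM hp (@ord_0 _ _ _ q). Qed.

Lemma ordMr n p q : ordg n q -> ordg n (p * q).
Proof. by move=> hq; rewrite mulrC; apply: ordMl. Qed.

Lemma ord_minor p q (s t : P) :
  ordg 1 (p - 1) -> ordg 1 (q - 1) -> ordg 1 s -> ordg 1 (p * q - s * t - 1).
Proof.
move=> hp hq hs; have -> : p * q - s * t - 1 = (p - 1) * q + (q - 1) - s * t by ring.
by apply: suppB; [apply: suppD => //|]; apply: ordMl.
Qed.

(** First-order expansion of the determinant near the identity; the cofactors of [A] differ from the
    identity by order 1. *)
Lemma det_add n (A E : 'M[P]_3) :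
    (forall i j, ordg 1 (A i j - (i == j)%:R)) -> (forall i j, ordg n.+1 (E i j)) ->
  ordg n.+2 (\det (A + E) - \det A - \tr E).
Proof.
move=> hA hE.
have hS i j : ordg 1 (A i j + E i j - (i == j)%:R).
  by rewrite addrAC; apply: suppD (hA i j) _; exact: (ord_le (isT : (1 <= n.+1)%N) (hE i j)).
rewrite /mxtrace !det3_cof big_ord3 /cof3 /next3 /= ![(A + E) _ _]mxE.
pose S i j := A i j + E i j.
have hM i j p : ordg 1 p -> ordg n.+2 (E i j * p) by move=> hp; rewrite -[n.+2]addn1; apply: ordM.
have offA i j : i != j -> ordg 1 (A i j).
  by move=> ne; move: (hA i j); rewrite (negPf ne) subr0.
have offS i j : i != j -> ordg 1 (S i j).
  by move=> ne; move: (hS i j); rewrite (negPf ne) subr0.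
set d := (X in ordg _ X).
(* An exact identity: [A] is replaced by [A + E] one row at a time, so each entry of [E] meets a
   minor minus its value at the identity. *)
have -> : d = E ix ix * (S iy iy * S iz iz - S iy iz * S iz iy - 1)
  - E ix iy * (S iy ix * S iz iz - S iy iz * S iz ix)
  + E ix iz * (S iy ix * S iz iy - S iz ix * S iy iy)
  + E iy ix * (A ix iz * S iz iy - A ix iy * S iz iz)
  + E iy iy * (A ix ix * S iz iz - A ix iz * S iz ix - 1)
  + E iy iz * (A ix iy * S iz ix - S iz iy * A ix ix)
  + E iz ix * (A ix iy * A iy iz - A ix iz * A iy iy)
  + E iz iy * (A ix iz * A iy ix - A iy iz * A ix ix)
  + E iz iz * (A ix ix * A iy iy - A ix iy * A iy ix - 1).
  by rewrite /d /S; ring.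
do 7![apply: suppD; last by
  apply: hM; first [by apply: ord_minor; [exact: hA | exact: hA | exact: offA]
    | by apply: ord_minor; [exact: hA | exact: hS | exact: offA]
    | by apply: suppB; apply: ordMl; first [exact: offA | exact: offS]]].
apply: suppB; apply: hM.
  by apply: ord_minor; [exact: hS | exact: hS | exact: offS].
by apply: suppB; apply: ordMl; exact: offS.
Qed.

Lemma det_jac_add u e n :
    (forall i, ordg M.+1 (u i - xi R m i)) -> (forall i, ordg (M + n.+1) (e i)) ->
  ordg n.+2 (\det (jac (fun i => u i + e i)) - \det (jac u) - div e).
Proof.
move=> hu he; have -> : jac (fun i => u i + e i) = jac u + jac e.
  by apply/matrixP => i j; rewrite !mxE dxiD.
have -> : div e = \tr (jac e) by apply: eq_bigr => i _; rewrite mxE.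
apply: det_add => i j; rewrite jacE; last exact: ord_dxiK.
by rewrite -dxi_xi -dxiB; apply: ord_dxiK; rewrite addn1.
Qed.

Lemma ord_cof3 (A : 'M[P]_3) : (forall i j, ordg 1 (A i j - (i == j)%:R)) ->
  forall i j, ordg 1 (cof3 A i j - (i == j)%:R).
Proof.
move=> hA.
have off i j : i != j -> ordg 1 (A i j).
  by move=> ne; move: (hA i j); rewrite (negPf ne) subr0.
apply: ord3_ind; apply: ord3_ind; rewrite /cof3 /next3 /= ?subr0.
all: first [by apply: ord_minor; [exact: hA | exact: hA | exact: off]
  | by apply: suppB; first [apply: ordMl; exact: off | apply: ordMr; exact: off]].
Qed.

End Jacobian.

(** * One step of the normalization, for fields and for maps *)

Section Iteration.
Variables (R : realFieldType) (m M : nat).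
Local Notation P := {mpoly R[3 + m]}.
Local Notation mon := 'X_{1..3 + m}.
Local Notation ordg := (ord (@grade m M)).
Implicit Types (p q g : P) (mo : mon) (u v f h phi : 'I_3 -> P).

(** The normal forms are carried with one scalar [g]; it is split into the unfolding parameters and
    [p] only at the end. *)
Definition nfield g (i : 'I_3) : P := Nmul (@xi R m) i + (i == iz)%:R * g.

Definition nmap g : 'I_3 -> P := Jmul (fun j => xi R m j + (j == iz)%:R * g).

(** Vanishes exactly when [phi] conjugates the two fields; no inverse of [phi] enters. *)
Definition field_defect v phi g i : P :=
  subst phi (v i) - \sum_(j < 3) jac phi i j * nfield g j.

Definition map_defect f phi g i : P := subst phi (f i) - subst (nmap g) (phi i).

Lemma ord_near phi : (forall i, ordg M.+1 (phi i - xi R m i)) -> forall i, ordg M (phi i).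
Proof.
move=> hphi i; rewrite -[phi i](subrK (xi R m i)).
by apply: suppD; [exact: (ord_le (leqnSn M) (hphi i)) | exact: ord_xi].
Qed.

Lemma ord_weaken n p : ordg (M + n.+1) p -> ordg M.+1 p.
Proof. by apply: ord_le; rewrite addnS ltnS leq_addr. Qed.

Lemma JmulB u v i : Jmul u i - Jmul v i = Jmul (fun j => u j - v j) i.
Proof. by rewrite /Jmul -sumrB; apply: eq_bigr => j _; rewrite scalerBr. Qed.

Lemma NmulB u v i : Nmul u i - Nmul v i = Nmul (fun j => u j - v j) i.
Proof. by rewrite /Nmul -sumrB; apply: eq_bigr => j _; rewrite scalerBr. Qed.

Lemma subst_Jmul phi i : subst phi (Jmul (@xi R m) i) = Jmul phi i.
Proof. by rewrite subst_sum; apply: eq_bigr => j _; rewrite substZ subst_xi. Qed.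

Lemma subst_Nmul phi i : subst phi (Nmul (@xi R m) i) = Nmul phi i.
Proof. by rewrite subst_sum; apply: eq_bigr => j _; rewrite substZ subst_xi. Qed.

Lemma jac_near phi : (forall i, ordg M.+1 (phi i - xi R m i)) ->
  forall i j, ordg 1 (jac phi i j - (i == j)%:R).
Proof. by move=> hphi i j; rewrite jacE -dxi_xi -dxiB; apply: ord_dxiK; rewrite addn1. Qed.

Lemma ord_e3 n g (i : 'I_3) : ordg n g -> ordg n ((i == iz)%:R * g).
Proof. by move=> hg; rewrite mulr_natl mulrb; case: ifP => // _; apply: supp0. Qed.

Lemma nmap_near g i : ordg M.+1 g -> ordg M.+1 (nmap g i - Jmul (@xi R m) i).
Proof.
move=> hg; rewrite /nmap JmulB; apply: ord_Jmul => j.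
by rewrite addrC addKr; apply: ord_e3.
Qed.

Lemma ord_nmap g i : ordg M.+1 g -> ordg M (nmap g i).
Proof.
move=> hg; apply: ord_Jmul => j; apply: suppD; first exact: ord_xi.
exact: ord_e3 (ord_le (leqnSn M) hg).
Qed.

Lemma nfield_near g i : ordg M.+1 g -> ordg M.+1 (nfield g i - Nmul (@xi R m) i).
Proof. by move=> hg; rewrite addrC addKr; apply: ord_e3. Qed.

Lemma div_nfield g : zfree g -> div (nfield g) = 0.
Proof.
move=> /zfree_dz g0; rewrite /div big_ord3 /nfield !NmulE /vec3 /=.
by rewrite !(dxiD, dxiM, dxi_xi, dxi_cst0, dxi_cst1) /= g0; ring.
Qed.

Lemma zfreeD p q : zfree p -> zfree q -> zfree (p + q).
Proof.
move=> hp hq mo; rewrite mcoeffD; have [->|/hp //] := eqVneq (p@_mo) 0.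
by rewrite add0r => /hq.
Qed.

(* By [div_pullback], [div r = - D (det D phi - 1)] to leading order. *)
Lemma field_step v phi g n : div v = 0 ->
    (forall i, ordg M.+1 (v i - Nmul (@xi R m) i)) ->
    (forall i, ordg M.+1 (phi i - xi R m i)) -> ordg M.+1 g -> zfree g ->
    ordg n.+1 (\det (jac phi) - 1) ->
    (forall i, ordg (M + n.+1) (field_defect v phi g i)) ->
  exists h k, [/\ forall i, ordg (M + n.+1) (h i), ordg (M + n.+1) k /\ zfree k,
    ordg n.+2 (\det (jac (fun i => phi i + h i)) - 1) &
    forall i, ordg (M + n.+2) (field_defect v (fun i => phi i + h i) (g + k) i)].
Proof.
move=> v0 hv hphi hg zg hdet hr.
set rho := \det (jac phi) in hdet *; set r := field_defect v phi g in hr *.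
have hdr i j : ordg n.+1 (dxi j (r i)) by apply: ord_dxiK.
have hcof := ord_cof3 (jac_near hphi).
have compat : ordg n.+2 (div r - shear (1 - rho)).
  have /= E := div_pullback phi v0 (div_nfield zg).
  (* Two replacements by leading parts, each gaining order 1: the cofactors by the identity here,
     the normal form field by [N xi] in [E2]. *)
  have E1 : \sum_(i < 3) \sum_(j < 3) (cof3 (jac phi) i j - (i == j)%:R) * dxi j (r i)
     = - \sum_(l < 3) nfield g l * dxi l rho - div r.
    rewrite -E /div -sumrB; apply: eq_bigr => i _.
    rewrite (bigD1 i) //= [in RHS](bigD1 i) //= eqxx mulrBl mul1r -!addrA; congr (_ + _).
    rewrite addrC; congr (_ + _); apply: eq_bigr => j ne.
    by rewrite eq_sym (negPf ne) subr0.
  have E2 : \sum_(l < 3) (nfield g l - Nmul (@xi R m) l) * dxi l (rho - 1)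
     = \sum_(l < 3) nfield g l * dxi l rho - shear rho.
    rewrite !big_ord3 !NmulE /shear /vec3 /= !dxiB !dxi_cst1; ring.
  have -> : div r - shear (1 - rho) = - (\sum_(l < 3) nfield g l * dxi l rho - shear rho)
     - (- \sum_(l < 3) nfield g l * dxi l rho - div r).
    by rewrite linearB /= [shear 1]/shear !dxi_cst1; ring.
  rewrite -E1 -E2; apply: suppB; first apply: suppN.
    apply: supp_sum => l _; apply: (@ord_le _ _ _ (M.+1 + (n.+1 - M))); first by lia.
    by apply: ordM; [apply: nfield_near | apply: ord_dxi].
  apply: supp_sum => i _; apply: supp_sum => j _.
  by rewrite -/(ord _ _ _) -[n.+2]add1n; apply: ordM.
have hs : ordg n.+1 (1 - rho) by rewrite -opprB; apply: suppN.
have [h [k [hh hk zk hdiv hsol]]] := solve_field hr hs compat.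
exists h, k; split; [exact: hh | by [] | |].
  have := det_jac_add hphi hh; rewrite -/rho => hd.
  set d := \det _ in hd *; have -> : d - 1 = (d - rho - div h) + (div h - (1 - rho)) by ring.
  by apply: suppD.
move=> i; set phi' := fun i => phi i + h i.
(* The first term is the solved homological equation; every other one combines a correction [h] or
   [k] with a deviation from the linear model or with another correction. *)
have -> : field_defect v phi' (g + k) i =
    (r i - (shear (h i) - Nmul h i) - (i == iz)%:R * k)
    + (subst phi' (v i - Nmul (@xi R m) i) - subst phi (v i - Nmul (@xi R m) i))
    - (jac phi i iz - (i == iz)%:R) * k
    - \sum_(j < 3) jac h i j * (nfield g j - Nmul (@xi R m) j) - jac h i iz * k.
  rewrite /r /field_defect !substB !subst_Nmul -[Nmul phi' i](subrK (Nmul phi i)) NmulB.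
  have -> : Nmul (fun j => phi' j - phi j) i = Nmul h i.
    by apply: eq_bigr => j _; rewrite /phi' addrC addKr.
  rewrite !big_ord3 /nfield !NmulE /vec3 /= !jacE /phi' !dxiD /shear; ring.
have hjh j : ordg n.+1 (jac h i j) by rewrite jacE; apply: ord_dxiK.
have hphi' j : ordg M.+1 (phi' j - xi R m j).
  by rewrite /phi' addrAC; apply: suppD; [exact: hphi | exact: ord_weaken (hh j)].
do 2?[apply: suppB]; first apply: suppB; first apply: suppD.
- by have := hsol i; rewrite -addnS.
- apply: (@ord_le _ _ _ (M.+1 + n.+1)); first by lia.
  apply: ord_substB (ord_near hphi') (ord_near hphi) _ (hv i) => j.
  by rewrite /phi' addrC addKr.
- by apply: (@ord_le _ _ _ (1 + (M + n.+1))); [lia | apply: ordM => //; apply: jac_near].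
- apply: supp_sum => j _; apply: (@ord_le _ _ _ (n.+1 + M.+1)); first by lia.
  by apply: ordM => //; apply: nfield_near.
by apply: (@ord_le _ _ _ (n.+1 + (M + n.+1))); [lia | apply: ordM].
Qed.

(* [phi o g + r = f o phi] with [det D f = det D g = 1]: comparing determinants
   gives [div (J^-1 r) = p - p o J] to leading order, where [p = det D phi - 1]. *)
Lemma map_step W f phi g n : (n.+2 <= W)%N ->
    ordg W (\det (jac f) - 1) ->
    (forall i, ordg M.+1 (f i - Jmul (@xi R m) i)) ->
    (forall i, ordg M.+1 (phi i - xi R m i)) -> ordg M.+1 g -> zfree g ->
    ordg n.+1 (\det (jac phi) - 1) ->
    (forall i, ordg (M + n.+1) (map_defect f phi g i)) ->
  exists h k, [/\ forall i, ordg (M + n.+1) (h i), ordg (M + n.+1) k /\ zfree k,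
    ordg n.+2 (\det (jac (fun i => phi i + h i)) - 1) &
    forall i, ordg (M + n.+2) (map_defect f (fun i => phi i + h i) (g + k) i)].
Proof.
move=> leW hW hf hphi hg zg hdet hr.
set rho := \det (jac phi) in hdet *; set r := map_defect f phi g in hr *.
have hJ i : ordg M (Jmul (@xi R m) i) by apply/ord_Jmul/ord_xi.
have compat : ordg n.+2 (div (Jinv r) - dshift (1 - rho)).
  (* [Jinv] brings the linear part of [phi o g] to the identity without changing determinants, so
     that [det_jac_add] applies. *)
  pose u := fun i => subst (nmap g) (phi i).
  have JinvB a b i : Jinv (fun j => a j - b j) i = Jinv a i - Jinv b i :> P.
    by move: i; apply: ord3_ind; rewrite /Jinv /vec3 /=; ring.
  have JinvD a b i : Jinv (fun j => a j + b j) i = Jinv a i + Jinv b i :> P.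
    by move: i; apply: ord3_ind; rewrite /Jinv /vec3 /=; ring.
  have hu i : ordg M.+1 (Jinv u i - xi R m i).
    have -> : xi R m i = Jinv (Jmul (@xi R m)) i.
      by move: i; apply: ord3_ind; rewrite /Jinv !JmulE /vec3 /=; ring.
    rewrite -JinvB; apply: ord_Jinv => j.
    have -> : u j - Jmul (@xi R m) j =
        subst (nmap g) (phi j - xi R m j) + (nmap g j - Jmul (@xi R m) j).
      by rewrite /u substB subst_xi; ring.
    apply: suppD; last exact: nmap_near.
    by apply: ord_subst => // l; apply: ord_nmap.
  have := det_jac_add hu (fun i => @ord_Jinv R m M _ _ i hr).
  have -> : jac (fun i => Jinv u i + Jinv r i) = jac (Jinv (fun i => subst phi (f i))).
    have E j : u j + r j = subst phi (f j) by rewrite addrC; apply: subrK.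
    by apply/matrixP => i j; rewrite 2!jacE -JinvD /Jinv !E.
  rewrite (det_jac_Jinv u) (det_jac_Jinv (fun i => subst phi (f i))).
  rewrite (det_jac_subst phi f) (det_jac_subst (nmap g) phi).
  rewrite -[\det (jac phi)]/rho.
  have -> : \det (jac (nmap g)) = 1.
    rewrite -det_jac_Jinv -[RHS](det_jac_nf zg); congr (\det _); apply/matrixP => i j.
    rewrite !jacE; congr dxi; move: i; apply: ord3_ind;
    by rewrite /Jinv /nmap !JmulE /vec3 /=; ring.
  move=> hd.
  (* Three errors: the quadratic part of the determinant, the deviation of [det D f] from 1, and the
     use of [J xi] in place of the normal form map. *)
  have E : div (Jinv r) - dshift (1 - rho) =
     - (subst phi (\det (jac f)) * rho - subst (nmap g) rho * 1 - div (Jinv r))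
     + subst phi (\det (jac f) - 1) * rho
     - (subst (nmap g) (rho - 1) - shift (rho - 1)).
    have -> : dshift (1 - rho) = (rho - 1) - shift (rho - 1).
      by rewrite -(opprB rho 1) raddfN /= /dshift opprB.
    rewrite (substB phi) (substB (nmap g)) 2!subst1.
    move: (subst phi _) (subst (nmap g) _) (shift _) (div (Jinv r)) => a b c d.
    by ring.
  rewrite E; apply: suppB; first apply: suppD.
  - exact: suppN.
  - by apply/ordMl/(ord_le leW)/ord_subst => //; apply: ord_near.
  rewrite /shift; apply: (@ord_le _ _ _ (n.+1 + 1)); first by lia.
  apply: ord_substB (fun j => ord_nmap (i := j) hg) hJ _ hdet => j.
  by rewrite [(M + 1)%N]addn1; apply: nmap_near.
have hs : ordg n.+1 (1 - rho) by rewrite -opprB; apply: suppN.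
have [h [k [hh hk zk hdiv hsol]]] := solve_map hr hs compat.
exists h, k; split; [exact: hh | by [] | |].
  have := det_jac_add hphi hh; rewrite -/rho => hd.
  set d := \det _ in hd *; have -> : d - 1 = (d - rho - div h) + (div h - (1 - rho)) by ring.
  by apply: suppD.
have hgk : ordg M.+1 (g + k).
  by apply: suppD => //; exact: ord_weaken hk.
move=> i; set phi' := fun i => phi i + h i.
have hphi' j : ordg M.+1 (phi' j - xi R m j).
  by rewrite /phi' addrAC; apply: suppD; [exact: hphi | exact: ord_weaken (hh j)].
(* Again the solved equation plus differences of substitutions, each controlled by [ord_substB]. *)
have -> : map_defect f phi' (g + k) i =
    (r i - (shift (h i) - Jmul h i) - Jmul (fun j => (j == iz)%:R * k) i)
    + (subst phi' (f i - Jmul (@xi R m) i) - subst phi (f i - Jmul (@xi R m) i))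
    - (subst (nmap (g + k)) (phi i - xi R m i) - subst (nmap g) (phi i - xi R m i))
    - (subst (nmap (g + k)) (h i) - shift (h i)).
  rewrite /r /map_defect !substB !subst_Jmul !subst_xi.
  have -> : Jmul phi' i = Jmul phi i + Jmul h i.
    by rewrite /Jmul -big_split /=; apply: eq_bigr => j _; rewrite -scalerDr.
  have -> : nmap (g + k) i = nmap g i + Jmul (fun j => (j == iz)%:R * k) i.
    rewrite /nmap /Jmul -big_split /=; apply: eq_bigr => j _; rewrite -scalerDr; congr (_ *: _).
    by ring.
  rewrite substD; move: (subst phi' (f i)) (subst phi (f i)) (subst (nmap g) (phi i)).
  move: (subst (nmap (g + k)) (phi i)) (subst (nmap (g + k)) (h i)) (shift (h i)).
  move: (Jmul h i) (Jmul phi i) (nmap g i) (Jmul _ i) => a b c d e1 e2 e3 e4 e5 e6.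
  by ring.
apply: suppB; first apply: suppB; first apply: suppD.
- by have := hsol i; rewrite -addnS.
- apply: (@ord_le _ _ _ (M.+1 + n.+1)); first by lia.
  apply: ord_substB (ord_near hphi') (ord_near hphi) _ (hf i) => j.
  by rewrite /phi' addrC addKr.
- apply: (@ord_le _ _ _ (M.+1 + n.+1)); first by lia.
  apply: (ord_substB (fun j => ord_nmap (i := j) hgk)
    (fun j => ord_nmap (i := j) hg) _ (hphi i)) => j.
  rewrite /nmap JmulB; apply: ord_Jmul => l.
  have -> : xi R m l + (l == iz)%:R * (g + k) - (xi R m l + (l == iz)%:R * g)
      = (l == iz)%:R * k by ring.
  exact: ord_e3.
rewrite /shift; apply: (@ord_le _ _ _ (M + n.+1 + 1)); first by lia.
apply: ord_substB (fun j => ord_nmap (i := j) hgk) hJ _ (hh i) => j.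
by rewrite [(M + 1)%N]addn1; apply: nmap_near.
Qed.

End Iteration.

(** * Translation between weights and total degree; reading off the unfolding parameters *)

Section Conclusion.
Variables (R : realFieldType) (m M : nat).
Hypothesis M_gt0 : (0 < M)%N.
Local Notation P := {mpoly R[3 + m]}.
Local Notation mon := 'X_{1..3 + m}.
Local Notation ordg := (ord (@grade m M)).
Implicit Types (p q g : P) (mo : mon) (u v f h phi : 'I_3 -> P).

(** The weight is [M] times the degree plus the parameter degree. *)
Lemma low_grade mo : (wt (grade M) mo <= M)%N ->
  mo = 0%MM \/ exists j : 'I_3, mo = U_(lshift m j)%MM.
Proof.
move=> le_wt; have [->|/eqP nz] := eqVneq mo 0%MM; [by left | right].
have /existsP[k mok] : [exists k, mo k != 0%N].
  apply: contraT => /existsPn mo0; case: nz; apply/mnmP => i.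
  by rewrite mnm0E; apply/eqP; move: (mo0 i); rewrite negbK.
have le_k : (U_(k) <= mo)%MM by rewrite lep1mP.
move: le_wt; rewrite -(submK le_k) wtD wtU.
have -> : wt (grade M) (mo - U_(k))%MM =
    (M * mdeg (mo - U_(k))%MM + \sum_(j < m) lexp (mo - U_(k))%MM j)%N.
  by rewrite wt_grade mdeg_split mulnDr mulSn; lia.
elim/split_ind: k {mok le_k} => j; last by rewrite /grade mkwt_r; lia.
rewrite grade_xi => le_M; exists j.
suff /eqP : mdeg (mo - U_(lshift m j))%MM = 0%N by rewrite mdeg_eq0 => /eqP->; rewrite add0m.
by move: le_M M_gt0; case: (mdeg _) => // d; rewrite mulnS; lia.
Qed.

Lemma mcoeff_linear (a : 'I_3 -> R) mo : (\sum_(j < 3) a j *: xi R m j)@_mo =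
  \sum_(j < 3) a j * (U_(lshift m j) == mo)%MM%:R.
Proof. by rewrite raddf_sum; apply: eq_bigr => j _; rewrite /= mcoeffZ mcoeffX. Qed.

Lemma mcoeff_linearU (a : 'I_3 -> R) k :
  (\sum_(j < 3) a j *: xi R m j)@_(U_(lshift m k)) = a k.
Proof.
have E j l : (U_(lshift m j) == U_(lshift m l) :> mon)%MM = (j == l).
  by rewrite -(inj_eq (@lshift_inj 3 m)); apply/eqP/eqP => [/mnmP/(_ (lshift m l))|->//];
    rewrite !mnm1E eqxx; case: eqP.
rewrite mcoeff_linear (bigD1 k) //= eqxx mulr1 big1 ?addr0 // => j ne.
by rewrite E (negPf ne) mulr0.
Qed.

Lemma mcoeff_linear0 (a : 'I_3 -> R) : (\sum_(j < 3) a j *: xi R m j)@_0%MM = 0.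
Proof.
rewrite mcoeff_linear big1 // => j _; case: eqP => [/mnmP/(_ (lshift m j))|]; rewrite ?mulr0 //.
by rewrite mnm1E eqxx mnm0E.
Qed.

Lemma ord_linear_part (a : 'I_3 -> R) p :
  at0 p = 0 -> (forall j, dxi0 p j = a j) -> ordg M.+1 (p - \sum_(j < 3) a j *: xi R m j).
Proof.
move=> p0 pa mo; apply: contraR; rewrite -leqNgt => /low_grade[->|[j ->]].
  by rewrite mcoeffB mcoeff_linear0 -/(at0 p) p0 subrr.
by rewrite mcoeffB mcoeff_linearU -/(dxi0 p j) pa subrr.
Qed.

Lemma near_id_ord phi : (forall i, ordg M.+1 (phi i - xi R m i)) -> near_id phi.
Proof.
move=> hphi i j.
have low mo : (wt (grade M) mo <= M)%N -> (phi i)@_mo = (xi R m i)@_mo.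
  move=> le_wt; apply/eqP; rewrite -subr_eq0 -mcoeffB; apply: contraTT le_wt => /hphi.
  by rewrite -ltnNge.
have E : xi R m i = \sum_(l < 3) (i == l)%:R *: xi R m l.
  rewrite (bigD1 i) //= eqxx scale1r big1 ?addr0 // => l ne.
  by rewrite eq_sym (negPf ne) scale0r.
rewrite /at0 /dxi0 !low ?wt0 ?wtU ?grade_xi // E.
by rewrite mcoeff_linear0 mcoeff_linearU.
Qed.

Lemma ord_eqmod K p q : eqmod K p q -> ordg (M * K.+1) (p - q).
Proof.
move=> hpq mo; apply: contraR; rewrite -ltnNge => lt_wt.
rewrite mcoeffB hpq ?subrr //; move: lt_wt; rewrite wt_grade mdeg_split.
move: (\sum_(j < m) _)%N (phase_deg mo) => l d; move: M_gt0; nia.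
Qed.

(** Degree at most [K] gives weight at most [(M + 1) K], which is below [M (K + 1)] exactly because
    [K < M]. *)
Lemma eqmod_ord K p q : (K < M)%N -> ordg (M * K.+1) (p - q) -> eqmod K p q.
Proof.
move=> lt_K hpq mo le_K; apply/eqP; rewrite -subr_eq0 -mcoeffB.
apply: contraTT le_K => /hpq; rewrite -ltnNge wt_grade mdeg_split.
move: (\sum_(j < m) _)%N (phase_deg mo) => l d; nia.
Qed.

(** Group the terms by their exponents in x and y. Order [M + 1] excludes 1, x and y themselves, so
    the three low coefficients vanish with the parameters. *)
Lemma nf_scalar_split g : ordg M.+1 g -> zfree g ->
  exists eps mu1 mu2 p, [/\ param_fun eps /\ param_fun mu1 /\ param_fun mu2,
    higher_xy p & nf_scalar eps mu1 mu2 p = g].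
Proof.
move=> og zg.
pose part a b := filt (fun mo => (xexp ix mo == a) && (xexp iy mo == b)) g.
pose p := filt (fun mo => (2 <= xexp ix mo + xexp iy mo)%N) g.
have partE a b mo : (part a b)@_mo = if (xexp ix mo == a) && (xexp iy mo == b) then g@_mo else 0.
  exact: mcoeff_filt.
have low mo : (wt (grade M) mo <= M)%N -> g@_mo = 0.
  by move=> le_wt; apply/eqP; apply: contraTT le_wt => /og; rewrite -ltnNge.
have xU (i : 'I_3) q mo : (dxi i q * xi R m i)@_mo = (xexp i mo)%:R * q@_mo.
  rewrite mulrC mcoeff_xiM; case E : (xexp i mo) => [|e]; first by rewrite mul0r.
  have le_i : (U_(lshift m i) <= mo)%MM by rewrite lep1mP -/(xexp i mo) E.
  by rewrite mcoeff_dxi xexpB E eqxx subn1 addmC submK.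
exists (part 0 0)%N, (dxi ix (part 1 0)%N), (dxi iy (part 0 1)%N), p; split.
(* The booleans act as exponents: [ix] gives the part linear in x, [iy] the part linear in y. *)
- have par (i : 'I_3) : param_fun (dxi i (part (i == ix) (i == iy))).
    split=> [|mo].
      rewrite /at0 mcoeff_dxi addm0 partE low ?if_same ?mulr0 //.
      by rewrite wtU grade_xi.
    rewrite mcoeff_dxi partE !xexpU.
    case: ifP => [/andP[/eqP a0 /eqP b0]|]; last by rewrite mulr0 eqxx.
    rewrite mulf_eq0 negb_or => /andP[_ /zg]; rewrite xexpU => c0.
    by apply: ord3_ind; rewrite -/(xexp _ _); lia.
  split; last by split; [exact: (par ix) | exact: (par iy)].
  split=> [|mo]; first by rewrite /at0 partE low ?if_same // wt0.
  rewrite partE; case: ifP => [/andP[/eqP a0 /eqP b0] /zg c0|]; last by rewrite eqxx.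
  exact: ord3_ind.
- by move=> mo; rewrite mcoeff_filt; case: ifP => [h /zg z|]; rewrite ?eqxx //.
- apply/mpolyP => mo; rewrite /nf_scalar !mcoeffD !xU !partE mcoeff_filt.
  by case: (xexp ix mo) (xexp iy mo) => [|[|a]] [|[|b]] /=;
    rewrite ?(mul0r, mul1r, mulr0, addr0, add0r) //.
Qed.


End Conclusion.

(** * Iteration of the steps and proof of the theorem *)

Section Normalization.
Variables (R : realFieldType) (m M : nat).
Local Notation P := {mpoly R[3 + m]}.
Local Notation ordg := (ord (@grade m M)).
Implicit Types (g : P) (v f phi : 'I_3 -> P).

Definition near_ord n phi g := [/\ forall i, ordg M.+1 (phi i - xi R m i),
  ordg M.+1 g, zfree g & ordg n.+1 (\det (jac phi) - 1)].

Lemma near_ord_id n : near_ord n (@xi R m) 0.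
Proof.
split=> [i|||]; first by rewrite subrr; apply: supp0.
- exact: supp0.
- by move=> mo; rewrite mcoeff0 eqxx.
have -> : \det (jac (@xi R m)) = 1.
  rewrite -[RHS](@det_jac_nf R m 0); last by move=> mo; rewrite mcoeff0 eqxx.
  by congr (\det _); apply/matrixP => i j; rewrite !jacE mulr0 addr0.
by rewrite subrr; apply: supp0.
Qed.

Lemma near_ord_step n phi g h k : near_ord n phi g ->
    (forall i, ordg (M + n.+1) (h i)) -> ordg (M + n.+1) k -> zfree k ->
    ordg n.+2 (\det (jac (fun i => phi i + h i)) - 1) ->
  near_ord n.+1 (fun i => phi i + h i) (g + k).
Proof.
move=> [hphi hg zg _] hh hk zk hdet; split=> //.
- by move=> i; rewrite addrAC; apply: suppD; [exact: hphi | exact: ord_weaken (hh i)].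
- by apply: suppD; [exact: hg | exact: ord_weaken hk].
exact: zfreeD.
Qed.

Lemma field_normalization v n : div v = 0 ->
    (forall i, ordg M.+1 (v i - Nmul (@xi R m) i)) ->
  exists phi g, near_ord n phi g /\ forall i, ordg (M + n.+1) (field_defect v phi g i).
Proof.
move=> v0 hv; elim: n => [|n [phi [g [[hphi hg zg hdet] hr]]]].
  exists (@xi R m), 0; split=> [|i]; first exact: near_ord_id.
  rewrite /field_defect subst_id (_ : \sum_(j < 3) _ = Nmul (@xi R m) i) ?addn1 //.
  rewrite (bigD1 i) //= jacE dxi_xi eqxx mul1r big1 ?addr0 => [|j ne].
    by rewrite /nfield mulr0 addr0.
  by rewrite jacE dxi_xi eq_sym (negPf ne) mul0r.
have [h [k [hh [hk zk] hdet' hr']]] := field_step v0 hv hphi hg zg hdet hr.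
by exists (fun i => phi i + h i), (g + k); split; first exact: near_ord_step.
Qed.

(** The determinant of [D f] is controlled only up to weight [W], which limits the number of
    steps. *)
Lemma map_normalization f W n : (n < W)%N -> ordg W (\det (jac f) - 1) ->
    (forall i, ordg M.+1 (f i - Jmul (@xi R m) i)) ->
  exists phi g, near_ord n phi g /\ forall i, ordg (M + n.+1) (map_defect f phi g i).
Proof.
move=> lt_n hW hf; elim: n lt_n => [|n IHn] lt_n.
  exists (@xi R m), 0; split=> [|i]; first exact: near_ord_id.
  rewrite /map_defect subst_id subst_xi addn1 (_ : nmap 0 i = Jmul (@xi R m) i) //.
  by rewrite /nmap /Jmul; apply: eq_bigr => j _; rewrite mulr0 addr0.
have [phi [g [[hphi hg zg hdet] hr]]] := IHn (ltnW lt_n).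
have [h [k [hh [hk zk] hdet' hr']]] := map_step lt_n hW hf hphi hg zg hdet hr.
by exists (fun i => phi i + h i), (g + k); split; first exact: near_ord_step.
Qed.

End Normalization.

Theorem theorem3 (R : realFieldType) (m : nat) :
  (* (a) divergence-free families of vector fields *)
  (forall v : 'I_3 -> {mpoly R[3 + m]},
      div v = 0 ->
      (forall i, at0 (v i) = 0) ->
      (forall i j, dxi0 (v i) j = Nmat R i j) ->
      forall K : nat,
      exists (phi : 'I_3 -> {mpoly R[3 + m]}) (eps mu1 mu2 p : {mpoly R[3 + m]}),
        [/\ near_id phi,
            eqmod K (\det (jac phi)) 1,
            param_fun eps /\ param_fun mu1 /\ param_fun mu2,
            higher_xy p &
            forall i : 'I_3,
              eqmod K (\sum_(j < 3) jac phi i j * nf_field eps mu1 mu2 p j)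
                      (subst phi (v i))]) /\
  (* (b) volume-preserving families of maps *)
  (forall (K : nat) (f : 'I_3 -> {mpoly R[3 + m]}),
      eqmod K (\det (jac f)) 1 ->
      (forall i, at0 (f i) = 0) ->
      (forall i j, dxi0 (f i) j = Jmat R i j) ->
      exists (phi : 'I_3 -> {mpoly R[3 + m]}) (eps mu1 mu2 p : {mpoly R[3 + m]}),
        [/\ near_id phi,
            eqmod K (\det (jac phi)) 1,
            param_fun eps /\ param_fun mu1 /\ param_fun mu2,
            higher_xy p &
            forall i : 'I_3,
              eqmod K (subst phi (f i)) (subst (nf_map eps mu1 mu2 p) (phi i))]).
Proof.
split=> [v v0 v_at0 v_lin K | K f hdet f_at0 f_lin].
  have M_gt0 : (0 < K.+1)%N by [].
  have hv i := ord_linear_part M_gt0 (v_at0 i) (v_lin i).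
  (* With [M = K + 1] the target weight [M (K + 1)] is the square of [K + 1]. *)
  have [phi [g [[hphi hg zg hdet] hr]]] := field_normalization (K.+1 * K.+1) v0 hv.
  have [eps [mu1 [mu2 [p [hpar hp Eg]]]]] := nf_scalar_split M_gt0 hg zg.
  exists phi, eps, mu1, mu2, p; split=> //.
  - exact: near_id_ord hphi.
  - by apply: (@eqmod_ord _ _ K.+1) => //; apply: ord_le hdet.
  move=> i; suff E : eqmod K (subst phi (v i))
      (\sum_(j < 3) jac phi i j * nf_field eps mu1 mu2 p j).
    by move=> mo le_mo; rewrite E.
  by apply: (@eqmod_ord _ _ K.+1) => //; rewrite /nf_field Eg; apply: ord_le (hr i); lia.
have M_gt0 : (0 < K.+1)%N by [].
have hf i := ord_linear_part M_gt0 (f_at0 i) (f_lin i).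
have hW := ord_eqmod M_gt0 hdet.
(* One step fewer than for fields, to stay below [W]; the determinant then has exactly the target
   order. *)
have lt_n : ((K.+1 * K.+1).-1 < K.+1 * K.+1)%N by lia.
have [phi [g [[hphi hg zg hphidet] hr]]] := map_normalization lt_n hW hf.
have [eps [mu1 [mu2 [p [hpar hp Eg]]]]] := nf_scalar_split M_gt0 hg zg.
exists phi, eps, mu1, mu2, p; split=> //.
- exact: near_id_ord hphi.
- by apply: (@eqmod_ord _ _ K.+1) => //; apply: ord_le hphidet; lia.
move=> i; apply: (@eqmod_ord _ _ K.+1) => //.
by rewrite /nf_map Eg; apply: ord_le (hr i); lia.
Qed.
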